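(* Let $k\ge 2$. There is a polynomial-time $k$-approximation algorithm for unbounded $k$-row-sparse covering integer programs, i.e. programs $\min\{c\cdot x: Ax\ge\mathbf{1},\ x\ge 0,\ x\in\mathbb{Z}^n\}$ where $c$ is a nonnegative rational vector and $A$ is a nonnegative rational matrix with at most $k$ nonzero entries in each row and all entries at most $1$.
   Context: A $k$-approximation algorithm returns a feasible solution of cost at most $k$ times the optimum. *)

(* Defs.v *)
From HB Require Import structures.
From mathcomp Require Import all_boot all_order all_algebra.
Set Implicit Arguments.
Unset Strict Implicit.
Unset Printing Implicit Defensive.
Import Order.TTheory GRing.Theory Num.Theory.
Local Open Scope ring_scope.

(** * Model of computation

    The random access machine under the logarithmic cost criterion of Aho,
    Hopcroft and Ullman, which is polynomially related to Turing machines,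
    with structured control flow instead of jumps. Memory cells, indexed by
    integers, hold arbitrary integers. *)

(** [bitlen z] is floor(log_2 |z|) + 1, and 1 for z = 0: [trunc_log 2 0 = 0]. *)
Definition bitlen (z : int) : nat := (trunc_log 2 `|z|%N).+1.

Definition memory : Type := int -> int.

Inductive binop : Type := Plus | Minus | Times | Quotient.

(** [Quotient] is Euclidean division, with quotient 0 for divisor 0. *)
Definition eval_op (o : binop) (a b : int) : int :=
  match o with
  | Plus => a + b
  | Minus => a - b
  | Times => a * b
  | Quotient => (a %/ b)%Z
  end.

(** [Fetch e] is the content of the cell whose address is the value of [e]
    (indirect addressing). *)
Inductive expr : Type :=
  | Const of int
  | Fetch of expr
  | Binop of binop & expr & expr.

Fixpoint eval (s : memory) (e : expr) : int :=
  match e with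
  | Const z => z
  | Fetch a => s (eval s a)
  | Binop o a b => eval_op o (eval s a) (eval s b)
  end.

Fixpoint eval_cost (s : memory) (e : expr) : nat :=
  match e with
  | Const z => bitlen z
  | Fetch a => eval_cost s a + bitlen (eval s a) + bitlen (s (eval s a))
  | Binop o a b =>
      eval_cost s a + eval_cost s b + bitlen (eval s a) + bitlen (eval s b)
  end%N.

Inductive prog : Type :=
  | Skip
  | Store of expr & expr (* address, value *)
  | Seq of prog & prog
  | IfPos of expr & prog & prog
  | WhilePos of expr & prog.

Definition update (s : memory) (a v : int) : memory :=
  fun b => if b == a then v else s b.

Definition test_cost (s : memory) (e : expr) : nat :=
  (eval_cost s e + bitlen (eval s e))%N.

(** [exec P s s' t]: started in memory [s], [P] halts in memory [s'] and its
    execution costs [t]. *)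
Inductive exec : prog -> memory -> memory -> nat -> Prop :=
  | ExecSkip s : exec Skip s s 1%N
  | ExecStore a e s :
      exec (Store a e) s (update s (eval s a) (eval s e))
        (eval_cost s a + bitlen (eval s a) + eval_cost s e + bitlen (eval s e))%N
  | ExecSeq P Q s s1 s2 t1 t2 :
      exec P s s1 t1 -> exec Q s1 s2 t2 -> exec (Seq P Q) s s2 (t1 + t2)%N
  | ExecIfTrue e P Q s s' t :
      0 < eval s e -> exec P s s' t ->
      exec (IfPos e P Q) s s' (test_cost s e + t)%N
  | ExecIfFalse e P Q s s' t :
      eval s e <= 0 -> exec Q s s' t ->
      exec (IfPos e P Q) s s' (test_cost s e + t)%N
  | ExecWhileTrue e P s s1 s2 t1 t2 :
      0 < eval s e -> exec P s s1 t1 -> exec (WhilePos e P) s1 s2 t2 ->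
      exec (WhilePos e P) s s2 (test_cost s e + t1 + t2)%N
  | ExecWhileFalse e P s :
      eval s e <= 0 -> exec (WhilePos e P) s s (test_cost s e).

(** The input occupies the cells 0, 1, 2, ...; all other cells contain 0. *)
Definition load (input : seq int) : memory :=
  fun a => match a with Posz i => nth 0 input i | Negz _ => 0 end.

Definition input_size (input : seq int) : nat := (\sum_(z <- input) bitlen z)%N.

(** * Covering integer programs  min { c x : A x >= 1, x >= 0, x integral } *)

Record cip : Type := CIP {
  nrows : nat;
  nvars : nat;
  cip_c : 'rV[rat]_nvars;
  cip_A : 'M[rat]_(nrows, nvars)
}.

Definition row_sparse_cip (k : nat) (I : cip) : Prop :=
  [/\ forall j, 0 <= cip_c I 0 j,
      forall i j, 0 <= cip_A I i j <= 1
    & forall i, (#|[set j | (cip_A I i j != 0)%R]| <= k)%N].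

Definition feasible (I : cip) (x : 'cV[int]_(nvars I)) : Prop :=
  (forall j, 0 <= x j 0) /\
  (forall i, 1 <= (cip_A I *m map_mx intr x) i 0).

Definition cost (I : cip) (x : 'cV[int]_(nvars I)) : rat :=
  (cip_c I *m map_mx intr x) 0 0.

Arguments feasible : clear implicits.
Arguments cost : clear implicits.

Definition is_optimum (I : cip) (v : rat) : Prop :=
  (exists2 x, feasible I x & cost I x = v) /\
  (forall x, feasible I x -> v <= cost I x).

Definition approximate_solution (k : nat) (I : cip) (x : 'cV[int]_(nvars I)) :
    Prop :=
  feasible I x /\ exists2 v, is_optimum I v & cost I x <= k%:R * v.

Arguments approximate_solution : clear implicits.

(** * Algorithms for covering integer programs *)

Definition encode_rat (q : rat) : seq int := [:: numq q; denq q].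

Definition encode (I : cip) : seq int :=
  [:: (nrows I)%:Z; (nvars I)%:Z]
  ++ flatten [seq encode_rat (cip_c I 0 j) | j <- enum 'I_(nvars I)]
  ++ flatten [seq encode_rat (cip_A I i j) |
               i <- enum 'I_(nrows I), j <- enum 'I_(nvars I)].

(** The output x_0, ..., x_(n-1) is read from the cells 0, ..., n-1. *)
Definition output (I : cip) (s : memory) : 'cV[int]_(nvars I) :=
  \col_j s (j : nat)%:Z.

Definition polynomial_time (D : cip -> Prop) (P : prog) : Prop :=
  exists p : {poly nat}, forall I, D I ->
    exists s t, exec P (load (encode I)) s t /\
                (t <= p.[input_size (encode I)])%N.

(** An infeasible instance has no optimum; on it the output is unconstrained. *)
Definition approximation_algorithm (k : nat) (D : cip -> Prop) (P : prog) :
    Prop :=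
  forall I, D I -> (exists x, feasible I x) ->
  forall s t, exec P (load (encode I)) s t ->
    approximate_solution k I (output I s).

(* Main.v *)
Require Import Defs.
From mathcomp Require Import all_boot all_order all_algebra.
From mathcomp Require Import zify.
From Stdlib Require Import FunctionalExtensionality Classical.
Set Implicit Arguments.
Unset Strict Implicit.
Unset Printing Implicit Defensive.
Import Order.TTheory GRing.Theory Num.Theory.
Local Open Scope ring_scope.

(** Local-ratio greedy algorithm. All data are scaled by the product [D] of
    their denominators, so that costs [c j] and entries [a i j] are integers
    and every right-hand side is [D]. We keep for each variable the amount
    [u j] spent on it, which buys [y j = floor (u j / c j)] copies. For a row
    with residual [r = D - sum_j a i j * y j > 0], let [b] be the least amount
    that, spent on a single variable of the row, gains at least [r / k], and
    spend [b] on every variable of the row. The row has at most [k] variables,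
    so any feasible [x] gains at least [r / k] over [y] on one of them: hence
    [sum_j max (c j * x j - u j) 0] drops by at least [b] while the spending
    grows by at most [k * b], and the total spending never exceeds
    [k * sum_j c j * x j]. Each step multiplies [r] by at most [1 - 1/k], so a
    row is satisfied after [O(k log D)] steps. *)

(** * Cost of executions *)

Lemma bitlen_leP (B : nat) (z : int) :
  (0 < B)%N -> (bitlen z <= B)%N = (`|z| < 2 ^ B)%N.
Proof.
move=> B_gt0; rewrite /bitlen; case: (posnP `|z|%N) => [->|z_gt0].
  by rewrite trunc_log0 expn_gt0 B_gt0.
apply/idP/idP => [lt_log|lt_z].
  by apply: leq_trans (trunc_log_ltn `|z|%N (ltnSn 1)) _; rewrite leq_exp2l.
rewrite -(ltn_exp2l _ _ (ltnSn 1)); apply: leq_ltn_trans lt_z.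
exact: trunc_logP.
Qed.

Lemma abs_lt_bitlen (z : int) : (`|z| < 2 ^ bitlen z)%N.
Proof. by rewrite -bitlen_leP. Qed.

Lemma bitlen_gt0 (z : int) : (0 < bitlen z)%N.
Proof. by []. Qed.

(** With [x] and [y] the powers of two above [|a|] and [|b|], a sum or difference is at most
    [x + y - 2 < x * y] in absolute value, and a Euclidean quotient never exceeds its dividend. *)
Lemma bitlen_eval_op (o : binop) (a b : int) :
  (bitlen (eval_op o a b) <= bitlen a + bitlen b)%N.
Proof.
rewrite bitlen_leP // expnD.
have := abs_lt_bitlen a; have := abs_lt_bitlen b.
have : (1 < 2 ^ bitlen a)%N by rewrite -{1}(expn0 2) ltn_exp2l.
have : (1 < 2 ^ bitlen b)%N by rewrite -{1}(expn0 2) ltn_exp2l.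
move: (2 ^ bitlen a)%N (2 ^ bitlen b)%N => x y.
case: o => /= y1 x1 hb ha.
- by nia.
- by nia.
- by rewrite abszM ltn_mul.
- have le_q : (`|(a %/ b)%Z| <= `|a|)%N.
    by nia.
  by nia.
Qed.

(** Static coefficient of [B] in the length of a value. A fetched content counts 1 however long its
    address is, because every cell has at most [B] bits. *)
Fixpoint expr_bits (e : expr) : nat :=
  match e with
  | Const z => bitlen z
  | Fetch _ => 1
  | Binop _ a b => expr_bits a + expr_bits b
  end%N.

Fixpoint expr_cost (e : expr) : nat :=
  match e with
  | Const z => bitlen z
  | Fetch a => expr_cost a + expr_bits a + 1
  | Binop _ a b => expr_cost a + expr_cost b + expr_bits a + expr_bits b
  end%N.

(** Static coefficient of [B] in the running time. A conditional is charged for both branches, so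
    that the result is visibly a polynomial in [N]; a loop makes one test more than it has
    rounds. *)
Fixpoint prog_cost (N : nat) (P : prog) : nat :=
  match P with
  | Skip => 1
  | Store a e => expr_cost a + expr_bits a + expr_cost e + expr_bits e
  | Seq P Q => prog_cost N P + prog_cost N Q
  | IfPos e P Q =>
      expr_cost e + expr_bits e + (prog_cost N P + prog_cost N Q)
  | WhilePos e P =>
      N.+1 * (expr_cost e + expr_bits e) + N * prog_cost N P
  end%N.

Definition bounded (B : nat) (s : memory) : Prop :=
  forall a, (bitlen (s a) <= B)%N.

Lemma bitlen_eval (B : nat) (s : memory) (e : expr) :
  (0 < B)%N -> bounded B s -> (bitlen (eval s e) <= expr_bits e * B)%N.
Proof.
move=> B_gt0 sB; elim: e => [z|a _|o a IHa b IHb] /=.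
- by rewrite leq_pmulr.
- by rewrite mul1n.
- by rewrite mulnDl (leq_trans (bitlen_eval_op _ _ _)) // leq_add.
Qed.

Lemma eval_cost_le (B : nat) (s : memory) (e : expr) :
  (0 < B)%N -> bounded B s -> (eval_cost s e <= expr_cost e * B)%N.
Proof.
move=> B_gt0 sB; elim: e => [z|a IHa|o a IHa b IHb] /=.
- by rewrite leq_pmulr.
- by rewrite !mulnDl mul1n !leq_add // bitlen_eval.
- by rewrite !mulnDl !leq_add // bitlen_eval.
Qed.

Lemma test_cost_le (B : nat) (s : memory) (e : expr) :
  (0 < B)%N -> bounded B s ->
  (test_cost s e <= (expr_cost e + expr_bits e) * B)%N.
Proof.
by move=> B_gt0 sB; rewrite mulnDl leq_add ?eval_cost_le ?bitlen_eval.
Qed.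

(** An approximation algorithm must be correct on every halting execution; determinism reduces this
    to the one execution that is constructed. *)
Lemma exec_det (P : prog) (s s1 s2 : memory) (t1 t2 : nat) :
  exec P s s1 t1 -> exec P s s2 t2 -> s1 = s2.
Proof.
move=> ex1; elim: ex1 s2 t2 => {P s s1 t1}.
- by move=> s s2 t2 ex2; inversion ex2.
- by move=> a e s s2 t2 ex2; inversion ex2.
- move=> P Q s s1 s2 t1 t2 _ IH1 _ IH2 s3 t3 ex3.
  inversion ex3 as [| |? ? ? s1' ? ? ? exP exQ| | | |]; subst.
  by rewrite -(IH1 _ _ exP) in exQ; apply: IH2 exQ.
- move=> e P Q s s1 t e_gt0 _ IH s2 t2 ex2.
  by inversion ex2; subst; [apply: IH; eassumption | lia].
- move=> e P Q s s1 t e_le0 _ IH s2 t2 ex2.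
  by inversion ex2; subst; [lia | apply: IH; eassumption].
- move=> e P s s1 s2 t1 t2 e_gt0 _ IH1 _ IH2 s3 t3 ex3.
  inversion ex3 as [| | | | |? ? ? s1' ? ? ? ? exP exQ|]; subst; last by lia.
  by rewrite -(IH1 _ _ exP) in exQ; apply: IH2 exQ.
- by move=> e P s e_le0 s2 t2 ex2; inversion ex2; subst=> //; lia.
Qed.

(* [N] bounds the number of iterations of each loop and [B] the number of
   bits of each memory cell along the execution. *)
Definition run (N B : nat) (P : prog) (s s' : memory) : Prop :=
  bounded B s ->
  bounded B s' /\ exists2 t, exec P s s' t & (t <= prog_cost N P * B)%N.

Section Run.

Variables (N B : nat) (B_gt0 : (0 < B)%N).
Local Notation run := (run N B).

Lemma run_skip (s : memory) : run Skip s s.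
Proof. by move=> sB; split=> //; exists 1%N; [constructor | rewrite mul1n]. Qed.

Lemma run_store (a e : expr) (s s' : memory) :
  (bitlen (eval s e) <= B)%N -> update s (eval s a) (eval s e) = s' ->
  run (Store a e) s s'.
Proof.
move=> eB <- sB; split; first by move=> b; rewrite /update; case: ifP.
eexists; first exact: ExecStore.
by rewrite !mulnDl !leq_add ?eval_cost_le ?bitlen_eval.
Qed.

Lemma run_seq (P Q : prog) (s s1 s2 : memory) :
  run P s s1 -> run Q s1 s2 -> run (Seq P Q) s s2.
Proof.
move=> runP runQ /runP[/runQ[s2B [t2 ex2 t2B]] [t1 ex1 t1B]].
split=> //; exists (t1 + t2)%N; first exact: ExecSeq ex1 ex2.
by rewrite mulnDl leq_add.
Qed.

Lemma run_if_pos (e : expr) (P Q : prog) (s s' : memory) :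
  0 < eval s e -> run P s s' -> run (IfPos e P Q) s s'.
Proof.
move=> e_gt0 runP sB; have [s'B [t ex tB]] := runP sB.
split=> //; eexists; first exact: ExecIfTrue e_gt0 ex.
rewrite mulnDl leq_add ?test_cost_le //.
by rewrite (leq_trans tB) // leq_mul // leq_addr.
Qed.

Lemma run_if_npos (e : expr) (P Q : prog) (s s' : memory) :
  eval s e <= 0 -> run Q s s' -> run (IfPos e P Q) s s'.
Proof.
move=> e_le0 runQ sB; have [s'B [t ex tB]] := runQ sB.
split=> //; eexists; first exact: ExecIfFalse e_le0 ex.
rewrite mulnDl leq_add ?test_cost_le //.
by rewrite (leq_trans tB) // leq_mul // leq_addl.
Qed.

(** The index of the invariant bounds the number of rounds left: each round consumes one unit, so a
    positive test at index 0 is contradictory. *)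
Lemma while_inv (I : nat -> memory -> Prop) (e : expr) (P : prog) :
  (forall q s, I q s -> 0 < eval s e ->
     exists2 q', q = q'.+1 & exists2 s', run P s s' & I q' s') ->
  forall q s, (q <= N)%N -> I q s ->
  exists2 s', run (WhilePos e P) s s' & eval s' e <= 0 /\ exists q', I q' s'.
Proof.
move=> step q s qN Is.
(* The induction needs the cost for the actual index [q]; it is relaxed to [N] only at the end. *)
suff [s' [runP e_le0 Is']] : exists s',
    [/\ bounded B s -> bounded B s' /\ exists2 t, exec (WhilePos e P) s s' t &
          (t <= (q.+1 * (expr_cost e + expr_bits e) + q * prog_cost N P) * B)%N,
        eval s' e <= 0 & exists q', I q' s'].
  exists s' => // sB; have [s'B [t ex tB]] := runP sB.
  split=> //; exists t => //; apply: leq_trans tB _.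
  by rewrite leq_mul //= leq_add // leq_mul.
elim: q s {qN} Is => [|q IH] s Is; case: (ltrP 0 (eval s e)) => e0.
- by have [] := step _ _ Is e0.
- exists s; split=> //; last by exists 0%N.
  move=> sB; split=> //; eexists; first exact: ExecWhileFalse.
  by rewrite mul0n addn0 mul1n test_cost_le.
- have [_ [<-] [s1 run1 Is1]] := step _ _ Is e0.
  have [s' [run2 e_le0 Is']] := IH _ Is1; exists s'; split=> // sB.
  have [s1B [t1 ex1 t1B]] := run1 sB; have [s'B [t2 ex2 t2B]] := run2 s1B.
  split=> //; eexists; first exact: ExecWhileTrue e0 ex1 ex2.
  have := test_cost_le e B_gt0 sB; move: t1B t2B => /=.
  by nia.
- exists s; split=> //; last by exists q.+1.
  move=> sB; split=> //; eexists; first exact: ExecWhileFalse.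
  by have := test_cost_le e B_gt0 sB; nia.
Qed.

End Run.

Arguments run_store {N B}.
Arguments run_skip {N B}.

(** * Memory layout and counting loops *)

(** [Negz q] is the address [-(q+1)], so the list holds the registers at negative addresses and [ar]
    the data at the others. *)
Definition ram (ar : nat -> int) (sc : seq int) : memory :=
  fun a => match a with Posz p => ar p | Negz q => nth 0 sc q end.

Definition interleave (A U : nat -> int) (p : nat) : int :=
  if odd p then U p./2 else A p./2.

Definition upd (f : nat -> int) (p : nat) (v : int) (q : nat) : int :=
  if q == p then v else f q.

Lemma update_ram_neg (ar : nat -> int) (sc : seq int) (q : nat) (v : int) :
  update (ram ar sc) (Negz q) v = ram ar (set_nth 0 sc q v).
Proof.
apply: functional_extensionality => -[p|p] //=.
by rewrite /update nth_set_nth.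
Qed.

Lemma update_ram_pos (ar : nat -> int) (sc : seq int) (q : nat) (v : int) :
  update (ram ar sc) (Posz q) v = ram (upd ar q v) sc.
Proof. by apply: functional_extensionality => -[p|p]. Qed.

Lemma upd_interleave_even (A U : nat -> int) (q : nat) (v : int) :
  upd (interleave A U) (2 * q) v = interleave (upd A q v) U.
Proof.
apply: functional_extensionality => p; rewrite /upd /interleave.
case: eqP => [->|]; first by rewrite mul2n odd_double doubleK eqxx.
by case: ifP => //; case: eqP => //; lia.
Qed.

Lemma upd_interleave_odd (A U : nat -> int) (q : nat) (v : int) :
  upd (interleave A U) (2 * q + 1) v = interleave A (upd U q v).
Proof.
apply: functional_extensionality => p; rewrite /upd /interleave.
case: eqP => [->|].
  by rewrite mul2n addn1 /= odd_double /= uphalf_double eqxx.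
by case: ifP => //; case: eqP => //; lia.
Qed.

Lemma interleave_even (A U : nat -> int) (q : nat) :
  interleave A U (2 * q) = A q.
Proof. by rewrite /interleave mul2n odd_double doubleK. Qed.

Lemma interleave_odd (A U : nat -> int) (q : nat) :
  interleave A U (2 * q + 1) = U q.
Proof. by rewrite /interleave mul2n addn1 /= odd_double uphalf_double. Qed.

Declare Scope expr_scope.
Delimit Scope expr_scope with X.
Notation "a + b" := (Binop Plus a b) : expr_scope.
Notation "a - b" := (Binop Minus a b) : expr_scope.
Notation "a * b" := (Binop Times a b) : expr_scope.
Notation "a %/ b" := (Binop Defs.Quotient a b) : expr_scope.
Notation "P ;; Q" := (Seq P Q) (at level 60, right associativity).

Definition num (n : nat) : expr := Const (Posz n).
Definition var (x : nat) : expr := Fetch (Const (Negz x)).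
Definition assign (x : nat) (e : expr) : prog := Store (Const (Negz x)) e.
Arguments num n /.
Arguments var x /.
Arguments assign x e /.

Definition for_down (x : nat) (P : prog) : prog :=
  WhilePos (var x) (P ;; assign x (var x - num 1)%X).

Definition even_cell (q : expr) : expr := (num 2 * q)%X.
Definition odd_cell (q : expr) : expr := (num 2 * q + num 1)%X.
Arguments even_cell q /.
Arguments odd_cell q /.

(** [st q c] is the memory with the work for indices above [q] done and the loop register equal to
    [c]. The two are separate because the body finishes index [q.+1] before the register is
    decremented. *)
Lemma run_for_down (N B : nat) (B_gt0 : (0 < B)%N) (x : nat) (P : prog)
    (Q : nat) (st : nat -> int -> memory) :
  (forall q c, st q c (Negz x) = c) ->
  (forall q c c', update (st q c) (Negz x) c' = st q c') ->
  (Q <= N)%N -> (bitlen Q%:Z <= B)%N ->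
  (forall q, (q < Q)%N -> run N B P (st q.+1 q.+1%:Z) (st q q.+1%:Z)) ->
  run N B (for_down x P) (st Q Q%:Z) (st 0%N 0).
Proof.
move=> stx st_upd QN QB body.
have [] := @while_inv N B B_gt0
  (fun q s => (q <= Q)%N /\ s = st q q%:Z) (var x)
  (P ;; assign x (var x - num 1)%X) _ Q (st Q Q%:Z) QN.
- move=> [|q] s [qQ ->]; rewrite /= stx // => _; exists q => //.
  exists (st q q%:Z); last by split=> //; apply: ltnW.
  apply: run_seq (body _ qQ) _.
  have eq_q : q.+1%:Z - 1 = q%:Z by lia.
  apply: run_store => //; rewrite /= stx eq_q //.
  by move: QB; rewrite !bitlen_leP //=; lia.
- by [].
- move=> s' runs [s'x [q [_ s'E]]]; rewrite s'E /= stx in s'x.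
  have q0 : q = 0%N by lia.
  by rewrite s'E q0 in runs.
Qed.

(* The cells [2 q] and [2 q + 1] hold the numerator and denominator of the
   [q]-th input entry, [q = 0] being the pair of dimensions, [q = j] the [j]-th
   cost and [q = i n + j] the entry [(i, j)], with [i] and [j] counted from 1.
   After scaling, [2 q] holds the scaled entry and, for [q = j <= n],
   [2 q + 1] the amount spent on variable [j]. The registers are the cells of
   negative address. *)
Section Program.

Local Open Scope expr_scope.

Definition rows := var 1.
Definition cols := var 0.
Definition scale := var 2.
Definition idx := var 3.
Definition row := var 4.
Definition fuel := var 5.
Definition resid := var 6.
Definition price := var 7.
Definition entry : expr := Fetch (even_cell (row * cols + idx)).
Definition unit_cost : expr := Fetch (even_cell idx).
Definition spent : expr := Fetch (odd_cell idx).

Definition prog_denominators : prog :=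
  assign 2 (num 1) ;; assign 3 (cols + rows * cols) ;;
  for_down 3 (assign 2 (scale * Fetch (odd_cell idx))).

Definition prog_scale : prog :=
  assign 3 (cols + rows * cols) ;;
  for_down 3
    (Store (even_cell idx)
       (Fetch (even_cell idx) * scale %/ Fetch (odd_cell idx)) ;;
     Store (odd_cell idx) (num 0)).

(* A variable of cost 0 is given [D] copies once and for all, which satisfies
   every row containing it; its cost is set to 1 to make it a valid divisor. *)
Definition prog_free_variables : prog :=
  assign 3 cols ;;
  for_down 3
    (IfPos unit_cost Skip
       (Store (even_cell idx) (num 1) ;; Store (odd_cell idx) scale)).

Definition prog_residual : prog :=
  assign 6 scale ;; assign 3 cols ;;
  for_down 3 (assign 6 (resid - entry * (spent %/ unit_cost))).

(** The amount that raises the number of copies from [floor (u / c)] by the ceiling of [r / (k w)],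
    hence gains at least [r / k]. The ceiling is computed as the floor of
    [(r + k w - 1) / (k w)]. *)
Definition bid_expr (k : nat) : expr :=
  unit_cost * (spent %/ unit_cost
    + (resid + num k * entry - num 1) %/ (num k * entry)) - spent.

(** The price 0 stands for no bid so far, which is unambiguous because bids are positive. *)
Definition prog_price (k : nat) : prog :=
  assign 7 (num 0) ;; assign 3 cols ;;
  for_down 3
    (IfPos entry
       (IfPos price
          (IfPos (price - bid_expr k) (assign 7 (bid_expr k)) Skip)
          (assign 7 (bid_expr k)))
       Skip).

Definition prog_pay : prog :=
  assign 3 cols ;;
  for_down 3 (IfPos entry (Store (odd_cell idx) (spent + price)) Skip).

(** The fuel is an upper bound for the residual of a coverable row, shrunk by the guaranteed factor
    in each round. Testing the fuel instead of the residual makes the loop stop even on a row that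
    no variable can satisfy. *)
Definition prog_row (k : nat) : prog :=
  assign 5 scale ;;
  WhilePos fuel
    (prog_residual ;; IfPos resid (prog_price k ;; prog_pay) Skip ;;
     assign 5 (fuel * num k.-1 %/ num k)).

(** Variables are treated in increasing order: the value for variable [j] is read from cells [2 j]
    and [2 j + 1] and written to cell [j - 1], so no data still to be read is overwritten. *)
Definition prog_output : prog :=
  assign 3 cols ;;
  for_down 3
    (Store (cols - idx)
       (Fetch (odd_cell (cols - idx + num 1))
        %/ Fetch (even_cell (cols - idx + num 1)))).

(* The test on [cols] keeps the running time polynomial when there are no
   variables: the number of rows may then be exponential in the input size. *)
Definition cip_prog (k : nat) : prog :=
  assign 0 (Fetch (num 1)) ;; assign 1 (Fetch (num 0)) ;;
  prog_denominators ;; prog_scale ;; prog_free_variables ;;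
  assign 4 rows ;; IfPos cols (for_down 4 (prog_row k)) Skip ;; prog_output.

End Program.

Definition residual (A U : nat -> int) (n : nat) (D : int) (i : nat) : int :=
  D - \sum_(1 <= j < n.+1) A (i * n + j)%N * (U j %/ A j)%Z.

Definition bid (k : nat) (A U : nat -> int) (n i : nat) (r : int) (j : nat) :
    int :=
  let w := A (i * n + j)%N in
  A j * ((U j %/ A j)%Z + ((r + k%:Z * w - 1) %/ (k%:Z * w))%Z) - U j.

(** A right fold, because the loop counts down and meets the smallest index last. *)
Definition lowest (k : nat) (A U : nat -> int) (n i : nat) (r : int)
    (js : seq nat) : int :=
  foldr (fun j b =>
    let v := bid k A U n i r j in
    if 0 < A (i * n + j)%N then
      if 0 < b then if 0 < b - v then v else b else v
    else b) 0 js.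

Definition pay (A U : nat -> int) (n i : nat) (b : int) (j : nat) : int :=
  if (0 < j <= n)%N && (0 < A (i * n + j)%N) then U j + b else U j.

Ltac simpl_ram :=
  rewrite /= -?PoszM -?PoszD /= ?update_ram_neg ?update_ram_pos
    ?upd_interleave_even ?upd_interleave_odd /=
    ?interleave_even ?interleave_odd.

(** * Effect of each loop of the program on the memory *)

Section Loops.

Variables (N B : nat) (B_gt0 : (0 < B)%N).
Local Notation run := (run N B).
Local Notation fits z := (bitlen z <= B)%N.
Variables (n m : nat).
Hypotheses (nN : (n <= N)%N) (nB : fits n%:Z).

Lemma run_denominators (A U : nat -> int) (d q i f r b : int) :
  (n + m * n <= N)%N -> fits (n + m * n)%N%:Z ->
  (forall p, (p <= n + m * n)%N ->
     fits (\prod_(p.+1 <= h < (n + m * n).+1) U h)) ->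
  run prog_denominators
    (ram (interleave A U) [:: n%:Z; m%:Z; d; q; i; f; r; b])
    (ram (interleave A U)
       [:: n%:Z; m%:Z; \prod_(1 <= h < (n + m * n).+1) U h; 0; i; f; r; b]).
Proof.
set Q := (n + m * n)%N => QN QB prodB.
pose st p c := ram (interleave A U)
  [:: n%:Z; m%:Z; \prod_(p.+1 <= h < Q.+1) U h; c; i; f; r; b].
apply: run_seq.
  apply: (run_store B_gt0); last by simpl_ram.
  by have := prodB _ (leqnn Q); rewrite big_geq.
apply: (run_seq (s1 := st Q Q%:Z)).
  by apply: (run_store B_gt0); [simpl_ram | simpl_ram; rewrite /st big_geq].
apply: (run_for_down B_gt0 (st := st)) => // [? ? ?|p pQ].
  exact: update_ram_neg.
have prodE : \prod_(p.+1 <= h < Q.+1) U h =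
    (\prod_(p.+2 <= h < Q.+1) U h) * U p.+1.
  by rewrite big_ltn 1?mulrC.
apply: (run_store B_gt0); first by simpl_ram; rewrite -prodE prodB // ltnW.
by simpl_ram; rewrite -prodE.
Qed.

Lemma run_scale (A U : nat -> int) (D q i f r b : int) :
  (n + m * n <= N)%N -> fits (n + m * n)%N%:Z ->
  (forall p, (0 < p <= n + m * n)%N -> fits (A p * D %/ U p)%Z) ->
  run prog_scale
    (ram (interleave A U) [:: n%:Z; m%:Z; D; q; i; f; r; b])
    (ram (interleave
       (fun p => if (0 < p <= n + m * n)%N then (A p * D %/ U p)%Z else A p)
       (fun p => if (0 < p <= n + m * n)%N then 0 else U p))
       [:: n%:Z; m%:Z; D; 0; i; f; r; b]).
Proof.
set Q := (n + m * n)%N => QN QB scaleB.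
pose st p c := ram (interleave
    (fun h => if (p < h <= Q)%N then (A h * D %/ U h)%Z else A h)
    (fun h => if (p < h <= Q)%N then 0 else U h))
  [:: n%:Z; m%:Z; D; c; i; f; r; b].
apply: (run_seq (s1 := st Q Q%:Z)).
  apply: (run_store B_gt0); first by simpl_ram.
  simpl_ram; rewrite /st; congr (ram (interleave _ _) _);
    by apply: functional_extensionality => h; case: ifP => //; lia.
apply: (run_for_down B_gt0 (st := st)) => // [? ? ?|p pQ].
  exact: update_ram_neg.
apply: run_seq; first apply: (run_store B_gt0) => //.
  by simpl_ram; rewrite ltnn scaleB.
apply: run_store => //; simpl_ram; rewrite ltnn /=.
congr (ram (interleave _ _) _); apply: functional_extensionality => h.
  by rewrite /upd; case: (h =P p.+1) => [->|hp]; do ?case: ifP => //; lia.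
by rewrite /upd; case: (h =P p.+1) => [->|hp]; do ?case: ifP => //; lia.
Qed.

Lemma run_free_variables (A U : nat -> int) (D q i f r b : int) :
  fits D ->
  run prog_free_variables
    (ram (interleave A U) [:: n%:Z; m%:Z; D; q; i; f; r; b])
    (ram (interleave
       (fun j => if (0 < j <= n)%N && (A j <= 0) then 1 else A j)
       (fun j => if (0 < j <= n)%N && (A j <= 0) then D else U j))
       [:: n%:Z; m%:Z; D; 0; i; f; r; b]).
Proof.
move=> DB.
pose st p c := ram (interleave
    (fun j => if (p < j <= n)%N && (A j <= 0) then 1 else A j)
    (fun j => if (p < j <= n)%N && (A j <= 0) then D else U j))
  [:: n%:Z; m%:Z; D; c; i; f; r; b].
apply: (run_seq (s1 := st n n%:Z)).
  apply: (run_store B_gt0) => //.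
  simpl_ram; rewrite /st; congr (ram (interleave _ _) _);
    by apply: functional_extensionality => h; case: ifP => //; lia.
apply: (run_for_down B_gt0 (st := st)) => // [? ? ?|p pn].
  exact: update_ram_neg.
case: (ltrP 0 (A p.+1)) => Ap.
  apply: (run_if_pos B_gt0); first by simpl_ram; rewrite ltnn.
  suff -> : st p p.+1%:Z = st p.+1 p.+1%:Z by exact: run_skip.
  congr (ram (interleave _ _) _); apply: functional_extensionality => h;
    by case: (h =P p.+1) => [->|hp]; do ?case: ifP => //; lia.
apply: (run_if_npos B_gt0); first by simpl_ram; rewrite ltnn.
apply: run_seq; first apply: (run_store B_gt0) => //.
apply: run_store => //; simpl_ram.
congr (ram (interleave _ _) _); apply: functional_extensionality => h;
  by rewrite /upd; case: (h =P p.+1) => [->|hp]; do ?case: ifP => //; lia.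
Qed.

Lemma run_residual (A U : nat -> int) (D q f r b : int) (i : nat) :
  fits D ->
  (forall p, (p <= n)%N -> fits (D -
     \sum_(p.+1 <= j < n.+1) A (i * n + j)%N * (U j %/ A j)%Z)) ->
  run prog_residual
    (ram (interleave A U) [:: n%:Z; m%:Z; D; q; i%:Z; f; r; b])
    (ram (interleave A U)
       [:: n%:Z; m%:Z; D; 0; i%:Z; f; residual A U n D i; b]).
Proof.
move=> DB sumB.
pose st p c := ram (interleave A U) [:: n%:Z; m%:Z; D; c; i%:Z; f;
  D - \sum_(p.+1 <= j < n.+1) A (i * n + j)%N * (U j %/ A j)%Z; b].
apply: run_seq; first exact: (run_store B_gt0).
apply: (run_seq (s1 := st n n%:Z)).
  apply: (run_store B_gt0) => //.
  by simpl_ram; rewrite /st big_geq // subr0.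
apply: (run_for_down B_gt0 (st := st)) => // [? ? ?|p pn].
  exact: update_ram_neg.
have sumE : D - \sum_(p.+1 <= j < n.+1) A (i * n + j)%N * (U j %/ A j)%Z =
    D - (\sum_(p.+2 <= j < n.+1) A (i * n + j)%N * (U j %/ A j)%Z) -
    A (i * n + p.+1)%N * (U p.+1 %/ A p.+1)%Z.
  by rewrite (big_ltn (m := p.+1)) // opprD addrA addrAC.
apply: (run_store B_gt0); first by simpl_ram; rewrite -sumE sumB // ltnW.
by simpl_ram; rewrite -sumE.
Qed.

Lemma run_price (k : nat) (A U : nat -> int) (D q f r b : int) (i : nat) :
  (forall j, (0 < j <= n)%N -> 0 < A (i * n + j)%N ->
     fits (bid k A U n i r j)) ->
  run (prog_price k)
    (ram (interleave A U) [:: n%:Z; m%:Z; D; q; i%:Z; f; r; b])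
    (ram (interleave A U) [:: n%:Z; m%:Z; D; 0; i%:Z; f; r;
       lowest k A U n i r (index_iota 1 n.+1)]).
Proof.
move=> bidB.
pose st p c := ram (interleave A U) [:: n%:Z; m%:Z; D; c; i%:Z; f; r;
  lowest k A U n i r (index_iota p.+1 n.+1)].
apply: run_seq; first exact: (run_store B_gt0).
apply: (run_seq (s1 := st n n%:Z)).
  apply: (run_store B_gt0) => //.
  by simpl_ram; rewrite /st /index_iota subnn.
apply: (run_for_down B_gt0 (st := st)) => // [? ? ?|p pn].
  exact: update_ram_neg.
have lowE : lowest k A U n i r (index_iota p.+1 n.+1) =
    let b := lowest k A U n i r (index_iota p.+2 n.+1) in
    let v := bid k A U n i r p.+1 in
    if 0 < A (i * n + p.+1)%N then
      if 0 < b then if 0 < b - v then v else b else v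
    else b.
  rewrite {1}/index_iota subSS -(subnSK pn).
  by [].

rewrite /(st p) lowE /=; have := bidB p.+1.
set v := bid _ _ _ _ _ _ _; rewrite pn => /(_ isT) vB.
have bidE : eval (st p.+1 p.+1%:Z) (bid_expr k) = v by simpl_ram.
have entryE : eval (st p.+1 p.+1%:Z) entry = A (i * n + p.+1)%N by simpl_ram.
case: ifP => [w_gt0|/negbT w_le0]; last first.
  by apply: (run_if_npos B_gt0); [rewrite entryE leNgt | exact: run_skip].
have store_v : run (assign 7 (bid_expr k)) (st p.+1 p.+1%:Z)
    (ram (interleave A U) [:: n%:Z; m%:Z; D; p.+1%:Z; i%:Z; f; r; v]).
  by apply: (run_store B_gt0); rewrite bidE; [exact: vB | simpl_ram].
apply: (run_if_pos B_gt0); first by rewrite entryE.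
case: ifP => [b_gt0|/negbT b_le0]; last first.
  by apply: (run_if_npos B_gt0) => //; rewrite leNgt.
apply: (run_if_pos B_gt0) => //.
have subE : eval (st p.+1 p.+1%:Z) (price - bid_expr k)%X =
  lowest k A U n i r (index_iota p.+2 n.+1) - v by rewrite -bidE.
case: ifP => [lt_vb|/negbT le_bv].
  by apply: (run_if_pos B_gt0); rewrite ?subE.
by apply: (run_if_npos B_gt0); [rewrite subE leNgt | exact: run_skip].
Qed.

Lemma run_pay (A U : nat -> int) (D q f r b : int) (i : nat) :
  (forall j, (0 < j <= n)%N -> 0 < A (i * n + j)%N -> fits (U j + b)) ->
  run prog_pay
    (ram (interleave A U) [:: n%:Z; m%:Z; D; q; i%:Z; f; r; b])
    (ram (interleave A (pay A U n i b))
       [:: n%:Z; m%:Z; D; 0; i%:Z; f; r; b]).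
Proof.
move=> payB.
pose st p c := ram (interleave A
   (fun j => if (p < j <= n)%N && (0 < A (i * n + j)%N) then U j + b else U j))
  [:: n%:Z; m%:Z; D; c; i%:Z; f; r; b].
apply: (run_seq (s1 := st n n%:Z)).
  apply: (run_store B_gt0) => //.
  simpl_ram; rewrite /st; congr (ram (interleave _ _) _).
  by apply: functional_extensionality => h; case: ifP => //; lia.
apply: (run_for_down B_gt0 (st := st)) => // [? ? ?|p pn].
  exact: update_ram_neg.
case: (ltrP 0 (A (i * n + p.+1)%N)) => Ap.
  apply: (run_if_pos B_gt0); first by simpl_ram.
  apply: run_store => //; first by simpl_ram; rewrite ltnn payB.
  simpl_ram; rewrite ltnn /=.
  congr (ram (interleave _ _) _); apply: functional_extensionality => h.
  by rewrite /upd; case: (h =P p.+1) => [->|hp]; do ?case: ifP => //; lia.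
apply: (run_if_npos B_gt0); first by simpl_ram.
suff -> : st p p.+1%:Z = st p.+1 p.+1%:Z by exact: run_skip.
congr (ram (interleave _ _) _); apply: functional_extensionality => h.
by case: (h =P p.+1) => [->|hp]; do ?case: ifP => //; lia.
Qed.

Lemma run_output (A U : nat -> int) (D q i f r b : int) :
  (forall j, (0 < j <= n)%N -> fits (U j %/ A j)%Z) ->
  exists2 s, run prog_output
      (ram (interleave A U) [:: n%:Z; m%:Z; D; q; i; f; r; b]) s &
    forall j, (j < n)%N -> s j%:Z = (U j.+1 %/ A j.+1)%Z.
Proof.
move=> outB.
pose st p c := ram
   (fun j => if (j < n - p)%N then (U j.+1 %/ A j.+1)%Z else interleave A U j)
  [:: n%:Z; m%:Z; D; c; i; f; r; b].
exists (st 0%N 0); last by move=> j jn; rewrite /= subn0 jn.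
apply: (run_seq (s1 := st n n%:Z)).
  apply: (run_store B_gt0) => //.
  by simpl_ram; rewrite /st subnn.
apply: (run_for_down B_gt0 (st := st)) => // [? ? ?|p pn].
  exact: update_ram_neg.
have valE : eval (st p.+1 p.+1%:Z)
       (Fetch (odd_cell (cols - idx + num 1))
        %/ Fetch (even_cell (cols - idx + num 1)))%X =
     (U (n - p.+1).+1 %/ A (n - p.+1).+1)%Z.
  rewrite /= subzn // -?PoszD -?PoszM -?PoszD /= (addn1 (n - p.+1)).
  rewrite interleave_even interleave_odd.
  by rewrite !ifF //; lia.
apply: run_store => //; rewrite valE; first by apply: outB; lia.
rewrite /= subzn // update_ram_pos; congr (ram _ _).
apply: functional_extensionality => h; rewrite /upd.
by case: (h =P (n - p.+1)%N) => [->|hp]; do ?case: ifP => //; lia.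
Qed.

End Loops.

(** * Analysis of the greedy algorithm *)

(** The first two terms of the binomial expansion of [(x + 1) ^ (t + 1)]. *)
Lemma expn_succ_ge (x t : nat) : (x ^ t.+1 + t.+1 * x ^ t <= x.+1 ^ t.+1)%N.
Proof.
elim: t => [|t IH]; first by rewrite !expn1 expn0 muln1 addn1.
rewrite (expnS x.+1) (expnS x t.+1); move: IH; rewrite (expnS x t).
by move: (x ^ t)%N (x.+1 ^ t.+1)%N => a b; nia.
Qed.

(** This is [(1 - 1/k) ^ k <= 1/2], obtained from the binomial bound at [x = t = k - 1]; rounding
    down only helps. *)
Lemma iter_fuel_half (k f : nat) : (0 < k)%N ->
  (2 * iter k (fun g => g * k.-1 %/ k) f <= f)%N.
Proof.
case: k => // k _; set h := fun g => _.
have iterP t : (k.+1 ^ t * iter t h f <= k ^ t * f)%N.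
  elim: t => [|t IH]; first by rewrite !expn0.
  have hP g : (k.+1 * h g <= k * g)%N.
    by rewrite /h mulnC [leqRHS]mulnC leq_trunc_div.
  rewrite iterS !expnS; have := hP (iter t h f); move: IH.
  by move: (k ^ t)%N (k.+1 ^ t)%N (iter t h f) (h _) => a b c d; nia.
rewrite -(leq_pmul2l (m := k.+1 ^ k.+1)) ?expn_gt0 //.
have := iterP k.+1; have := expn_succ_ge k k; rewrite expnS.
by move: (k ^ k)%N (_ ^ _)%N (iter _ _ _) => a b c; nia.
Qed.

Lemma iter_fuel_eq0 (k L f : nat) : (0 < k)%N -> (f < 2 ^ L)%N ->
  iter (k * L) (fun g => g * k.-1 %/ k)%N f = 0%N.
Proof.
move=> k_gt0; elim: L f => [|L IH] f fL; first by rewrite muln0 /=; lia.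
rewrite mulnSr iterD; apply: IH.
by have := iter_fuel_half f k_gt0; rewrite expnS in fL; lia.
Qed.

(** * The local-ratio invariant *)

Section Greedy.

Variables (k n m : nat) (D : int) (A : nat -> int) (free : pred nat).
Local Notation w i j := (A (i * n + j)%N).
Local Notation isvar j := (0 < j <= n)%N.
Hypotheses (k_gt0 : (0 < k)%N) (D_gt0 : 0 < D).
Hypothesis cost_gt0 : forall j, isvar j -> 0 < A j.
Hypothesis cost_free : forall j, isvar j -> free j -> A j = 1.
Hypothesis entry_ge0 : forall i j, (0 < i <= m)%N -> isvar j -> 0 <= w i j.
Hypothesis row_sparse : forall i, (0 < i <= m)%N ->
  (count (fun j => (0 < w i j)%R) (index_iota 1 n.+1) <= k)%N.

(** For a free variable [A j] is the artificial divisor 1, while its cost in the instance is 0. *)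
Definition true_cost (j : nat) : int := if free j then 0 else A j.

Definition coverable (i : nat) : Prop := exists2 j, isvar j & 0 < w i j.

(** Only coverable rows are imposed, so that coverings exist even for an infeasible instance; the
    running time must be bounded there as well. *)
Definition covering (x : nat -> int) : Prop :=
  (forall j, isvar j -> 0 <= x j) /\
  forall i, (0 < i <= m)%N -> coverable i ->
    D <= \sum_(1 <= j < n.+1) w i j * x j.

Definition unpaid (x U : nat -> int) : int :=
  \sum_(1 <= j < n.+1) Num.max (true_cost j * x j - U j) 0.

(* The local-ratio invariant: every unit of cost that a covering solution [x]
   still has to pay is worth [k] units of our spending. *)
Definition solvent (U : nat -> int) : Prop :=
  [/\ forall j, isvar j -> 0 <= U j,
      forall j, isvar j -> free j -> U j = D
    & forall x, covering x ->
        (\sum_(1 <= j < n.+1) if free j then 0 else U j) + k%:Z * unpaid x U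
        <= k%:Z * \sum_(1 <= j < n.+1) true_cost j * x j].

Lemma mem_vars (j : nat) : (j \in index_iota 1 n.+1) = isvar j.
Proof. by rewrite mem_index_iota ltnS. Qed.

Lemma sum_vars_le (F G : nat -> int) : (forall j, isvar j -> F j <= G j) ->
  \sum_(1 <= j < n.+1) F j <= \sum_(1 <= j < n.+1) G j.
Proof.
move=> le_FG; rewrite big_seq [leRHS]big_seq; apply: ler_sum => j.
by rewrite mem_vars => /le_FG.
Qed.

Lemma sum_vars_le1 (F G : nat -> int) (h : nat) (e : int) : isvar h ->
  (forall j, isvar j -> F j <= G j) -> F h + e <= G h ->
  \sum_(1 <= j < n.+1) F j + e <= \sum_(1 <= j < n.+1) G j.
Proof.
move=> hn le_FG le_h; have uniq_vars := iota_uniq 1 (n.+1 - 1).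
rewrite !(bigD1_seq h) ?mem_vars //= addrAC lerD //.
rewrite big_seq_cond [leRHS]big_seq_cond; apply: ler_sum => j.
by rewrite mem_vars => /andP[/le_FG].
Qed.

Lemma le_sum_vars (G : nat -> int) (h : nat) (e : int) : isvar h ->
  (forall j, isvar j -> 0 <= G j) -> e <= G h ->
  e <= \sum_(1 <= j < n.+1) G j.
Proof.
move=> hn G_ge0 le_h; have := @sum_vars_le1 (fun=> 0) G h e hn G_ge0.
by rewrite big1_eq !add0r; apply.
Qed.

Lemma sum_support (i : nat) (e : int) :
  \sum_(1 <= j < n.+1) (if 0 < w i j then e else 0) =
  (count (fun j => (0 < w i j)%R) (index_iota 1 n.+1))%:Z * e.
Proof.
by rewrite -big_mkcond big_const_seq iter_addr_0 -mulr_natl natz.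
Qed.

Lemma covering_const : covering (fun _ => D).
Proof.
split=> [j _|i im [j jn w_gt0]]; first exact: ltW.
apply: (le_sum_vars jn) => [h hn|]; last by nia.
by rewrite mulr_ge0 ?entry_ge0 // ltW.
Qed.

(** [k] times the cost of the constant covering [D], which bounds the spending on non-free
    variables, plus the [D] placed on a free one. *)
Definition spending_bound : int :=
  D + k%:Z * \sum_(1 <= j < n.+1) true_cost j * D.

Lemma true_cost_ge0 (j : nat) : isvar j -> 0 <= true_cost j.
Proof.
by move=> jn; rewrite /true_cost; case: ifP => // _; rewrite ltW ?cost_gt0.
Qed.

Lemma unpaid_ge0 (x U : nat -> int) : 0 <= unpaid x U.
Proof. by apply: sumr_ge0 => j _; rewrite le_max lexx orbT. Qed.

Lemma spent_le (U : nat -> int) (x : nat -> int) : solvent U -> covering x ->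
  \sum_(1 <= j < n.+1) (if free j then 0 else U j) <=
  k%:Z * \sum_(1 <= j < n.+1) true_cost j * x j.
Proof.
move=> [_ _ budget] xP; apply: le_trans (budget x xP).
by rewrite lerDl mulr_ge0 // unpaid_ge0.
Qed.

Lemma solvent_le_bound (U : nat -> int) (j : nat) : solvent U -> isvar j ->
  0 <= U j <= spending_bound.
Proof.
move=> Us jn; have [U_ge0 U_free _] := Us; rewrite U_ge0 //=.
have sum_ge0 : 0 <= k%:Z * \sum_(1 <= j < n.+1) true_cost j * D.
  rewrite mulr_ge0 // big_seq; apply: sumr_ge0 => h.
  by rewrite mem_vars => hn; rewrite mulr_ge0 ?true_cost_ge0 // ltW.
case: (boolP (free j)) => fj; first by rewrite U_free // lerDl.
apply: le_trans (_ : U j <= \sum_(1 <= h < n.+1) if free h then 0 else U h) _.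
  apply: (le_sum_vars jn) => [h hn|]; last by rewrite (negPf fj).
  by case: ifP => // _; apply: U_ge0.
by apply: le_trans (spent_le Us covering_const) _; rewrite lerDr ltW.
Qed.

Lemma residual_le (U U' : nat -> int) (i : nat) : (0 < i <= m)%N ->
  (forall j, isvar j -> U j <= U' j) ->
  residual A U' n D i <= residual A U n D i.
Proof.
move=> im le_U; rewrite /residual lerD2l lerN2; apply: sum_vars_le => j jn.
by rewrite ler_wpM2l ?entry_ge0 // lez_pdiv2r ?le_U ?(ltW (cost_gt0 jn)).
Qed.

Lemma residual_le_scale (U : nat -> int) (i : nat) : (0 < i <= m)%N ->
  (forall j, isvar j -> 0 <= U j) -> residual A U n D i <= D.
Proof.
move=> im U_ge0; rewrite /residual gerBl big_seq; apply: sumr_ge0 => j.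
rewrite mem_vars => jn; rewrite mulr_ge0 ?entry_ge0 //.
by rewrite divz_ge0 ?U_ge0 // cost_gt0.
Qed.

(** * One payment on a row with positive residual *)

Section Step.

Variables (i : nat) (U : nat -> int).
Hypotheses (im : (0 < i <= m)%N) (Us : solvent U).
Let r := residual A U n D i.
Hypothesis r_gt0 : 0 < r.
Local Notation y j := (U j %/ A j)%Z.
Local Notation bidj := (bid k A U n i r).
Let need j : int := ((r + k%:Z * w i j - 1) %/ (k%:Z * w i j))%Z.
Let b := lowest k A U n i r (index_iota 1 n.+1).

Lemma need_ge1 (j : nat) : 0 < w i j -> 1 <= need j.
Proof. by move=> w_gt0; rewrite /need; nia. Qed.

Lemma needP (j : nat) : 0 < w i j -> r <= k%:Z * w i j * need j.
Proof. by move=> w_gt0; rewrite /need; nia. Qed.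

Lemma need_le (j : nat) (z : int) :
  0 < w i j -> r <= k%:Z * w i j * z -> need j <= z.
Proof. by move=> w_gt0 rz; rewrite /need; nia. Qed.

Lemma bidE (j : nat) : bidj j = A j * (y j + need j) - U j.
Proof. by []. Qed.

(** Since [y j] is a floor, [U j] is less than the cost of [y j + 1] copies, and at least one
    further copy is needed. *)
Lemma bid_gt0 (j : nat) : isvar j -> 0 < w i j -> 0 < bidj j.
Proof.
move=> jn w_gt0; rewrite bidE; have := need_ge1 w_gt0; have := cost_gt0 jn.
by move: (need j) (A j) (U j) => d a u; nia.
Qed.

Lemma bid_le (j : nat) : isvar j -> 0 < w i j -> bidj j <= A j * D.
Proof.
move=> jn w_gt0; rewrite bidE.
have leD : need j <= D.
  have [U_ge0 _ _] := Us.
  apply: need_le => //; have := residual_le_scale im U_ge0.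
  rewrite -/r; have : 1 <= k%:Z * w i j by nia.
  by move: (k%:Z * w i j) => kw; nia.
by have := cost_gt0 jn; move: (need j) (A j) (U j) leD => d a u; nia.
Qed.

Lemma lowestP (js : seq nat) : (forall j, j \in js -> isvar j) ->
  let b := lowest k A U n i r js in
  (forall j, j \in js -> 0 < w i j -> b <= bidj j) /\
  ((b = 0 /\ forall j, j \in js -> ~~ (0 < w i j)) \/
   (0 < b /\ exists j, [/\ j \in js, 0 < w i j & b = bidj j])).
Proof.
elim: js => [|j js IH] js_var; first by split=> //; left.
have {IH} [h hs|le_b b_att] := IH; first by rewrite js_var ?inE ?hs ?orbT.
have jn : isvar j by rewrite js_var ?mem_head.
rewrite /= -/(lowest k A U n i r js).
move: (lowest k A U n i r js) le_b b_att => z le_b b_att.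
case: ifP => w0; last first.
  split=> [h|]; first by rewrite inE => /orP[/eqP->|/le_b]; rewrite ?w0.
  case: b_att => [[b0 no]|[b_gt0 [h [hs wh bh]]]].
    by left; split=> // h; rewrite inE => /orP[/eqP->|/no]; rewrite ?w0.
  by right; split=> //; exists h; rewrite inE hs orbT.
have bj_gt0 := bid_gt0 jn w0.
case: b_att => [[b0 no]|[b_gt0 [h [hs wh bh]]]].
  rewrite b0 ltxx; split=> [h|]; last first.
    by right; split=> //; exists j; rewrite inE eqxx.
  by rewrite inE => /orP[/eqP->//|/no/negP].
rewrite b_gt0; case: ifP => lt_b.
  split=> [g|]; last by right; split=> //; exists j; rewrite inE eqxx.
  rewrite inE => /orP[/eqP->//|gs wg]; apply: le_trans (le_b _ gs wg).
  by rewrite subr_gt0 in lt_b; exact: ltW.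
split=> [g|]; last by right; split=> //; exists h; rewrite inE hs orbT.
rewrite inE => /orP[/eqP->|/le_b//] _.
by rewrite subr_gt0 in lt_b; rewrite leNgt lt_b.
Qed.

Lemma price_le (j : nat) : isvar j -> 0 < w i j -> b <= bidj j.
Proof.
move=> jn; have [le_b _] := lowestP (fun h => (etrans (esym (mem_vars h)))).
by apply: le_b; rewrite mem_vars.
Qed.

Lemma price_attained : coverable i ->
  0 < b /\ exists j, [/\ isvar j, 0 < w i j & b = bidj j].
Proof.
move=> [j jn wj]; have [_] := lowestP (fun h => (etrans (esym (mem_vars h)))).
case=> [[_ no]|[b_gt0 [h [hn wh bh]]]].
  by have := no j; rewrite mem_vars jn wj => /(_ isT).
by split=> //; exists h; rewrite -mem_vars.
Qed.

(** A free variable has [D] copies and positive entries are at least 1, so its presence would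
    already satisfy the row. *)
Lemma free_not_in_row (j : nat) : isvar j -> free j -> w i j = 0.
Proof.
move=> jn fj; apply/eqP; rewrite eq_le entry_ge0 // andbT leNgt.
apply/negP=> wj; have [U_ge0 U_free _] := Us.
have := r_gt0; rewrite /r /residual subr_gt0 ltNge => /negP; apply.
apply: (le_sum_vars jn) => [h hn|].
  by rewrite mulr_ge0 ?entry_ge0 // divz_ge0 ?U_ge0 ?cost_gt0.
by rewrite (cost_free jn fj) U_free // divz1; nia.
Qed.

(* If every variable of the row fell short of its [need], the row of [x]
   would be violated, as the row has at most [k] variables. *)
Lemma covering_reaches_need (x : nat -> int) : covering x -> coverable i ->
  exists2 j, isvar j & 0 < w i j /\ y j + need j <= x j.
Proof.
move=> [x_ge0 /(_ i im) xi] /[dup] cov /xi {}xi; apply: NNPP => short.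
(* Falling short of [need] means [k * w * (x - y) < r], hence at most [r - 1] by integrality. At
   most [k] variables contribute, so [x] gains at most [r - 1] over [y], whereas covering the row
   takes [r]. *)
have le_r1 : k%:Z * (\sum_(1 <= j < n.+1) w i j * x j
    - \sum_(1 <= j < n.+1) w i j * y j) <= k%:Z * (r - 1).
  apply: le_trans
    (_ : _ <= \sum_(1 <= j < n.+1) if 0 < w i j then r - 1 else 0) _.
    rewrite -sumrB mulr_sumr; apply: sum_vars_le => j jn.
    case: ifP => wj; last first.
      suff -> : w i j = 0 by rewrite !mul0r subr0 mulr0.
      by apply/eqP; rewrite eq_le entry_ge0 // leNgt wj.
    have lt_x : x j < y j + need j.
      by rewrite ltNge; apply/negP=> le_x; apply: short; exists j.
    have {lt_x} : ~~ (r <= k%:Z * w i j * (x j - y j)).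
      by apply/negP=> /(need_le wj); lia.
    by rewrite -mulrBr mulrA; lia.
  rewrite sum_support ler_wpM2r //; first by lia.
  by rewrite lez_nat row_sparse.
have sumE : \sum_(1 <= j < n.+1) w i j * y j = D - r.
  by rewrite /r /residual opprB addrC subrK.
by move: le_r1; rewrite sumE; nia.
Qed.

Let U' := pay A U n i b.

Lemma pay_ge (j : nat) : U j <= U' j.
Proof.
rewrite /U' /pay; case: ifP => // _; rewrite lerDl.
have [_] := lowestP (fun h => (etrans (esym (mem_vars h)))).
by case=> [[b0 _]|[b_gt0 _]]; [rewrite /b b0 | apply: ltW].
Qed.

Lemma pay_uncoverable : ~ coverable i -> U' = U.
Proof.
move=> ncov; apply: functional_extensionality => j; rewrite /U' /pay.
by case: ifP => // /andP[jn wj]; case: ncov; exists j.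
Qed.

(** At the variable [h] where [x] reaches its need, [true_cost h * x h] is at least [U h] plus the
    bid of [h], hence at least [U h + b]. The unpaid part of [h] thus drops by the full [b], no
    other unpaid part grows, and row sparsity limits the new spending to [k * b]. *)
Lemma solvent_pay : solvent U'.
Proof.
have [cov|/pay_uncoverable-> //] := classic (coverable i).
have [U_ge0 U_free budget] := Us; have [b_gt0 _] := price_attained cov.
split=> [j jn|j jn fj|x xP].
- exact: le_trans (U_ge0 j jn) (pay_ge j).
- by rewrite /U' /pay (free_not_in_row jn fj) ltxx andbF U_free.
have [h hn [wh need_h]] := covering_reaches_need xP cov.
have unpaidP : unpaid x U' + b <= unpaid x U.
  apply: (sum_vars_le1 hn) => [j jn|].
    by have := pay_ge j; move: (U' j) (U j) (_ * _) => u' u c; lia.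
  have nfh : free h = false.
    by apply/negP=> fh; rewrite (free_not_in_row hn fh) in wh.
  rewrite /U' /pay hn wh /true_cost nfh /=.
  have := price_le hn wh; rewrite bidE; have := cost_gt0 hn.
  by move: b_gt0 need_h; clear; move: b (A h) (y h + need h) (U h) (x h); nia.
have spentP : \sum_(1 <= j < n.+1) (if free j then 0 else U' j) <=
    \sum_(1 <= j < n.+1) (if free j then 0 else U j) + k%:Z * b.
  apply: le_trans (_ : _ <= \sum_(1 <= j < n.+1)
    ((if free j then 0 else U j) + if 0 < w i j then b else 0)) _.
    apply: sum_vars_le => j jn; rewrite /U' /pay jn /=.
    by case: (free j); case: (0 < w i j); lia.
  rewrite big_split lerD2l sum_support ler_wpM2r ?(ltW b_gt0) //.
  by rewrite lez_nat row_sparse.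
by have := budget x xP; nia.
Qed.

(** The variable attaining the price reaches exactly [A h * (y h + need h)], so it gains [need h]
    copies, worth at least [r / k]; the other variables can only lower the residual further. *)
Lemma residual_pay : coverable i ->
  k%:Z * residual A U' n D i <= k.-1%:Z * r.
Proof.
move=> cov; have [b_gt0 [h [hn wh bh]]] := price_attained cov.
have : residual A U' n D i <= r - w i h * need h.
  rewrite /r /residual -addrA lerD2l -opprD lerN2.
  apply: (sum_vars_le1 hn) => [j jn|].
    rewrite ler_wpM2l ?entry_ge0 // lez_pdiv2r ?pay_ge // ltW ?cost_gt0 //.
  rewrite -mulrDr ler_wpM2l ?(ltW wh) //.
  rewrite /U' /pay hn wh /= bh bidE subrKC.
  by rewrite mulrC mulzK // lt0r_neq0 // cost_gt0.
by have := needP wh; nia.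
Qed.

End Step.

(** * Loops over rounds and rows, with bounds on rounds and bits *)

Section Rows.

Variables (N B L : nat).
Local Notation fits z := (bitlen z <= B)%N.
Local Notation top := (2 ^ B)%N%:Z.
Hypotheses (B_gt0 : (0 < B)%N) (nN : (n <= N)%N) (mN : (m <= N)%N).
Hypotheses (fuelN : (k * L <= N)%N) (DL : D < (2 ^ L)%N%:Z).
Hypotheses (n_top : n%:Z < top) (m_top : m%:Z < top).
Hypothesis bound_top : spending_bound < top.
Hypothesis price_top : forall j, isvar j -> A j * D < top.
Hypothesis row_top : forall i, (0 < i <= m)%N ->
  D + (\sum_(1 <= j < n.+1) w i j) * spending_bound < top.

Lemma fits_abs (z : int) : - top < z < top -> fits z.
Proof. by rewrite bitlen_leP //; lia. Qed.

Lemma scale_le_bound : D <= spending_bound.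
Proof.
rewrite lerDl mulr_ge0 // big_seq; apply: sumr_ge0 => j; rewrite mem_vars => jn.
by rewrite mulr_ge0 ?true_cost_ge0 // ltW.
Qed.

Lemma fits_scale : fits D.
Proof.
apply: fits_abs; have := scale_le_bound; have := bound_top; have := D_gt0.
by lia.
Qed.

Lemma fits_partial_residual (U : nat -> int) (i p : nat) :
  (0 < i <= m)%N -> solvent U -> (p <= n)%N ->
  fits (D - \sum_(p.+1 <= j < n.+1) w i j * (U j %/ A j)%Z).
Proof.
move=> im Us pn; have := row_top im.
have term_ge0 j : isvar j -> 0 <= w i j * (U j %/ A j)%Z.
  move=> jn; have /andP[U_ge0 _] := solvent_le_bound Us jn.
  by rewrite mulr_ge0 ?entry_ge0 // divz_ge0 ?cost_gt0.
have part_ge0 a c : (0 < a)%N -> (c <= n.+1)%N ->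
    0 <= \sum_(a <= j < c) w i j * (U j %/ A j)%Z.
  move=> a_gt0 cn; rewrite big_nat; apply: sumr_ge0 => j jac.
  by apply: term_ge0; lia.
have : \sum_(p.+1 <= j < n.+1) w i j * (U j %/ A j)%Z <=
    (\sum_(1 <= j < n.+1) w i j) * spending_bound.
  apply: le_trans (_ : _ <= \sum_(1 <= j < n.+1) w i j * (U j %/ A j)%Z) _.
    by rewrite [leRHS](big_cat_nat (n := p.+1)) //= lerDr part_ge0 //; lia.
  rewrite mulr_suml; apply: sum_vars_le => j jn.
  rewrite ler_wpM2l ?entry_ge0 //.
  have /andP[U_ge0 U_le] := solvent_le_bound Us jn; apply: le_trans U_le.
  by have := cost_gt0 jn; move: (A j) (U j) U_ge0 => a u; nia.
have := part_ge0 p.+1 n.+1 isT (leqnn _); have := D_gt0.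
move=> D0 S0 S1 top1; apply: fits_abs; move: S0 S1 top1.
by move: (\sum_(p.+1 <= j < n.+1) _) (_ * spending_bound) => S T; lia.
Qed.

Lemma run_row (U : nat -> int) (i : nat) (q f r b : int) :
  (0 < i <= m)%N -> solvent U ->
  exists U' q' r' b',
  [/\ run N B (prog_row k)
        (ram (interleave A U) [:: n%:Z; m%:Z; D; q; i%:Z; f; r; b])
        (ram (interleave A U') [:: n%:Z; m%:Z; D; q'; i%:Z; 0; r'; b']),
      solvent U', forall j, isvar j -> U j <= U' j
    & coverable i -> residual A U' n D i <= 0].
Proof.
move=> im Us; pose h g := (g * k.-1 %/ k)%N.
have [d Dd] : exists d : nat, D = d%:Z by exists `|D|%N; have := D_gt0; lia.
(* The index [t] counts the shrinkings that bring the fuel [g] to 0; initially [k * L] suffice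
   because [D < 2 ^ L]. *)
pose I t s := exists (g : nat) U1 q1 r1 b1,
  [/\ s = ram (interleave A U1) [:: n%:Z; m%:Z; D; q1; i%:Z; g%:Z; r1; b1],
      iter t h g = 0%N /\ (g <= d)%N, solvent U1,
      forall j, isvar j -> U j <= U1 j
    & coverable i -> residual A U1 n D i <= g%:Z].
have fitsN : fits n%:Z by apply: fits_abs; lia.
have [||s' runs [s'f [t [g [U1 [q1 [r1 [b1 [s'E _ U1s leU resU]]]]]]]]] :=
  @while_inv N B B_gt0 I fuel
    (prog_residual ;; IfPos resid (prog_price k ;; prog_pay) Skip ;;
     assign 5 (fuel * num k.-1 %/ num k)%X) _ (k * L)%N
    (ram (interleave A U) [:: n%:Z; m%:Z; D; q; i%:Z; D; r; b]) fuelN.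
- move=> t s [g [U1 [q1 [r1 [b1 [-> [itg gd] U1s leU resU]]]]]] /= g_gt0.
  case: t itg => [|t itg]; first by move=> /= g0; rewrite g0 in g_gt0.
  exists t => //; pose r2 := residual A U1 n D i.
  have hd : (h g <= d)%N by apply: leq_trans gd; rewrite /h; nia.
  have store_fuel U2 q2 b2 : run N B (assign 5 (fuel * num k.-1 %/ num k)%X)
      (ram (interleave A U2) [:: n%:Z; m%:Z; D; q2; i%:Z; g%:Z; r2; b2])
      (ram (interleave A U2) [:: n%:Z; m%:Z; D; q2; i%:Z; (h g)%:Z; r2; b2]).
    have valE : (g%:Z * k.-1%:Z %/ k)%Z = (h g)%:Z by rewrite -PoszM divz_nat.
    apply: (run_store B_gt0); rewrite /= valE.
      by have := fits_scale; rewrite !bitlen_leP // Dd; lia.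
    by rewrite update_ram_neg.
  have run_r : run N B prog_residual
      (ram (interleave A U1) [:: n%:Z; m%:Z; D; q1; i%:Z; g%:Z; r1; b1])
      (ram (interleave A U1) [:: n%:Z; m%:Z; D; 0; i%:Z; g%:Z; r2; b1]).
    apply: run_residual => // [|p pn]; first exact: fits_scale.
    exact: fits_partial_residual.
  case: (ltrP 0 r2) => r20; last first.
    exists (ram (interleave A U1)
      [:: n%:Z; m%:Z; D; 0; i%:Z; (h g)%:Z; r2; b1]).
      apply: (run_seq run_r); apply: run_seq (store_fuel _ _ _).
      by apply: (run_if_npos B_gt0) => //; exact: run_skip.
    exists (h g), U1, 0, r2, b1; split=> //; first by rewrite iterSr in itg.
    by move=> _; apply: le_trans r20 _.
  pose b2 := lowest k A U1 n i r2 (index_iota 1 n.+1).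
  pose U2 := pay A U1 n i b2.
  have U2s : solvent U2 := solvent_pay im U1s r20.
  exists (ram (interleave A U2) [:: n%:Z; m%:Z; D; 0; i%:Z; (h g)%:Z; r2; b2]).
    apply: (run_seq run_r); apply: run_seq (store_fuel _ _ _).
    apply: (run_if_pos B_gt0) => //; apply: run_seq.
      apply: run_price => // j jn wj; apply: fits_abs.
      have : 0 < bid k A U1 n i r2 j by apply: bid_gt0.
      have : bid k A U1 n i r2 j <= A j * D by apply: bid_le.
      by have := price_top jn; rewrite -/r2; lia.
    apply: run_pay => // j jn wj; apply: fits_abs.
    have := solvent_le_bound U2s jn; rewrite {1 2}/U2 /pay jn wj /= => bnd.
    by have := bound_top; lia.
  exists (h g), U2, 0, r2, b2; split=> //; first by rewrite iterSr in itg.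
  - by move=> j jn; apply: le_trans (leU j jn) (pay_ge _ _ _).
  (* The new residual is an integer at most [(k - 1) g / k], so the bound survives rounding the fuel
     down. *)
  - move=> cov; have := resU cov.
    have : k%:Z * residual A U2 n D i <= k.-1%:Z * r2 by apply: residual_pay.
    rewrite -/r2 /h; move: (r2) (residual A U2 n D i) => r3 r4.
    by move: k_gt0; clear; case: k => // k' _ /=; nia.
- exists d, U, q, r, b; rewrite Dd; split=> //.
    by split=> //; apply: iter_fuel_eq0 => //; have := DL; rewrite Dd; lia.
  have [U_ge0 _ _] := Us.
  by move=> _; rewrite -Dd; apply: residual_le_scale.
have g0 : g = 0%N by move: s'f; rewrite s'E /=; lia.
exists U1, q1, r1, b1; split=> //; last by rewrite g0 in resU.
apply: run_seq.
  apply: (run_store B_gt0); first exact: fits_scale.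
  exact: update_ram_neg.
by rewrite s'E g0 in runs.
Qed.

Lemma run_rows (U : nat -> int) (q f r b : int) : solvent U ->
  exists U' q' f' r' b',
  [/\ run N B (for_down 4 (prog_row k))
        (ram (interleave A U) [:: n%:Z; m%:Z; D; q; m%:Z; f; r; b])
        (ram (interleave A U') [:: n%:Z; m%:Z; D; q'; 0; f'; r'; b']),
      solvent U'
    & forall i, (0 < i <= m)%N -> coverable i -> residual A U' n D i <= 0].
Proof.
move=> Us.
(* Rows above [t] have been treated. They stay satisfied because later payments only increase the
   spending, which cannot raise a residual. *)
pose I t s := (t <= m)%N /\ exists U1 q1 f1 r1 b1,
  [/\ s = ram (interleave A U1) [:: n%:Z; m%:Z; D; q1; t%:Z; f1; r1; b1],
      solvent U1
    & forall i, (t < i <= m)%N -> coverable i -> residual A U1 n D i <= 0].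
have [||s' runs [s't [t [_ [U1 [q1 [f1 [r1 [b1 [s'E U1s resU]]]]]]]]]] :=
  @while_inv N B B_gt0 I (var 4)
    (prog_row k ;; assign 4 (var 4 - num 1)%X) _ m
    (ram (interleave A U) [:: n%:Z; m%:Z; D; q; m%:Z; f; r; b]) mN.
- move=> [|t] s [tm [U1 [q1 [f1 [r1 [b1 [-> U1s resU]]]]]]] //= _.
  exists t => //; have tm' : (0 < t.+1 <= m)%N by [].
  have [U2 [q2 [r2 [b2 [run2 U2s leU res2]]]]] := run_row q1 f1 r1 b1 tm' U1s.
  have valE : t.+1%:Z - 1 = t%:Z by lia.
  exists (ram (interleave A U2) [:: n%:Z; m%:Z; D; q2; t%:Z; 0; r2; b2]).
    apply: (run_seq run2); apply: (run_store B_gt0); rewrite /= valE.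
      by apply: fits_abs; have := m_top; lia.
    by rewrite update_ram_neg.
  split; first exact: ltnW.
  exists U2, q2, 0, r2, b2; split=> // i im cov.
  case: (i =P t.+1) => [it|/eqP it]; first by rewrite it in cov *; apply: res2.
  apply: le_trans (residual_le (U := U1) _ leU) (resU _ _ cov); first by lia.
  by move: it im; lia.
- by split=> //; exists U, q, f, r, b; split=> // i; lia.
have t0 : t = 0%N by move: s't; rewrite s'E /=; lia.
exists U1, q1, f1, r1, b1; rewrite t0 in s'E resU; split=> //.
by rewrite s'E in runs.
Qed.

End Rows.

End Greedy.

(** * Running the program on an encoded instance *)

Lemma prog_cost_poly (P : prog) (a : nat) :
  exists p : {poly nat}, forall L, p.[L] = prog_cost (a * L) P.
Proof.
pose poly_fun (g : nat -> nat) := exists p : {poly nat}, forall L, p.[L] = g L.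
have polyC c : poly_fun (fun=> c) by exists c%:P => L; rewrite hornerC.
have polyX : poly_fun (fun L => a * L)%N.
  by exists (a%:P * 'X) => L; rewrite hornerM hornerC hornerX.
have polyD f g : poly_fun f -> poly_fun g -> poly_fun (fun L => f L + g L)%N.
  by move=> [p pE] [q qE]; exists (p + q) => L; rewrite hornerD pE qE.
have polyM f g : poly_fun f -> poly_fun g -> poly_fun (fun L => f L * g L)%N.
  by move=> [p pE] [q qE]; exists (p * q) => L; rewrite hornerM pE qE.
suff : poly_fun (fun L => prog_cost (a * L) P) by [].
elim: P => /= [|x e|P IHP Q IHQ|e P IHP Q IHQ|e P IHP].
- exact: polyC.
- exact: polyC.
- exact: polyD.
- by apply: (polyD _ _ (polyC _)); apply: (polyD).
- apply: (polyD); last exact: polyM.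
  apply: polyM; last exact: polyC.
  have [p pE] := polyD _ _ (polyC 1%N) polyX.
  by exists p => L; rewrite pE add1n.
Qed.

Lemma size_flatten_pairs (T : Type) (f g : T -> int) (s : seq T) :
  size (flatten [seq [:: f x; g x] | x <- s]) = (2 * size s)%N.
Proof. by elim: s => //= x s ->; rewrite mulnS. Qed.

Lemma nth_flatten_pairs (T : Type) (f g : T -> int) (x0 : T) (s : seq T)
    (q : nat) : (q < size s)%N ->
  nth 0 (flatten [seq [:: f x; g x] | x <- s]) (2 * q) = f (nth x0 s q) /\
  nth 0 (flatten [seq [:: f x; g x] | x <- s]) (2 * q + 1) = g (nth x0 s q).
Proof.
elim: s q => //= x s IH [|q] // qs; have [fE gE] := IH q qs.
by rewrite -fE -gE mulnS.
Qed.

Lemma nth_allpairs_ord (m n : nat) (T : Type) (x0 : T)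
    (F : 'I_m -> 'I_n -> T) (i : 'I_m) (j : 'I_n) :
  nth x0 [seq F a c | a <- enum 'I_m, c <- enum 'I_n] (i * n + j) = F i j.
Proof.
have gen (s : seq 'I_m) (p : nat) : (p < size s)%N ->
    nth x0 [seq F a c | a <- s, c <- enum 'I_n] (p * n + j) = F (nth i s p) j.
  elim: s p => //= a s IH [|p] ps; rewrite nth_cat size_map size_enum_ord.
    by rewrite mul0n add0n ltn_ord (nth_map j) ?size_enum_ord // nth_ord_enum.
  by rewrite ifF ?mulSn; [rewrite -addnA addKn IH | lia].
by rewrite gen ?size_enum_ord // nth_ord_enum.
Qed.

Lemma sum_vars_ord (R : nmodType) (n : nat) (F : nat -> R) :
  \sum_(1 <= j < n.+1) F j = \sum_(j < n) F j.+1.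
Proof. by rewrite big_add1 big_mkord. Qed.

Lemma bounded_load (s : seq int) : (0 < input_size s)%N ->
  bounded (input_size s) (load s).
Proof.
move=> s_gt0 [p|p] /=; last by rewrite /bitlen trunc_log0.
case: (ltnP p (size s)) => ps; last first.
  by rewrite nth_default // /bitlen trunc_log0.
by rewrite /input_size (big_rem _ (mem_nth 0 ps)) leq_addr.
Qed.

Lemma prod_den_lt (s : seq rat) :
  \prod_(q <- s) denq q <= (2 ^ \sum_(q <- s) bitlen (denq q))%N%:Z.
Proof.
elim: s => [|q s IH]; first by rewrite !big_nil.
rewrite !big_cons expnD PoszM ler_pM ?(ltW (denq_gt0 q)) //.
  by apply: prodr_ge0 => p _; apply/ltW/denq_gt0.
by have := abs_lt_bitlen (denq q); have := denq_gt0 q; lia.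
Qed.

(** * The scaled instance obtained from the input *)

Section Instance.

Variables (k : nat) (I : cip).
Hypotheses (k_gt0 : (0 < k)%N) (Ik : row_sparse_cip k I).
Local Notation n := (nvars I).
Local Notation m := (nrows I).

Definition cip_entries : seq rat :=
  [seq cip_c I 0 j | j <- enum 'I_n]
  ++ [seq cip_A I i j | i <- enum 'I_m, j <- enum 'I_n].

Local Notation Q := (n + m * n)%N.

Lemma size_entries : size cip_entries = Q.
Proof. by rewrite size_cat size_map size_allpairs !size_enum_ord. Qed.

Lemma nth_entries_cost (j : 'I_n) : nth 0 cip_entries j = cip_c I 0 j.
Proof.
rewrite nth_cat size_map size_enum_ord ltn_ord.
by rewrite (nth_map j) ?size_enum_ord // nth_ord_enum.
Qed.

Lemma nth_entries_matrix (i : 'I_m) (j : 'I_n) :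
  nth 0 cip_entries (n + (i * n + j)) = cip_A I i j.
Proof.
rewrite nth_cat size_map size_enum_ord ltnNge leq_addr addKn.
exact: nth_allpairs_ord.
Qed.

Lemma entries_ge0 (q : nat) : 0 <= nth 0 cip_entries q.
Proof.
have [c_ge0 A_01 _] := Ik.
case: (ltnP q (size cip_entries)) => qs; last by rewrite nth_default.
have := mem_nth 0 qs; rewrite mem_cat => /orP[/mapP[j _ ->] //|].
by move=> /allpairsP[[i j] [_ _ ->]]; have /andP[] := A_01 i j.
Qed.

Definition num0 (q : nat) : int :=
  if q is q'.+1 then numq (nth 0 cip_entries q') else m%:Z.

(** The guard is for indices past the input, where memory holds 0 although [denq 0 = 1]. *)
Definition den0 (q : nat) : int :=
  if q is q'.+1 then (if (q' < Q)%N then denq (nth 0 cip_entries q') else 0)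
  else n%:Z.

Lemma encodeE : encode I =
  [:: m%:Z; n%:Z] ++ flatten [seq [:: numq q; denq q] | q <- cip_entries].
Proof.
rewrite /encode /cip_entries map_cat flatten_cat -map_comp /=.
by rewrite map_allpairs.
Qed.

Lemma load_encode :
  load (encode I) = ram (interleave num0 den0) [:: 0; 0; 0; 0; 0; 0; 0; 0].
Proof.
rewrite encodeE; apply: functional_extensionality => -[p|p] /=; last first.
  by do 8?[case: p => [//|p]]; rewrite /= nth_nil.
case: p => [//|[//|p]]; rewrite /= /interleave /= negbK.
have pE : p = (2 * p./2 + odd p)%N by rewrite mul2n addnC odd_double_half.
case: (ltnP p./2 (size cip_entries)) => ps; last first.
  rewrite nth_default; last by rewrite size_flatten_pairs; lia.
  rewrite size_entries in ps.
  by case: odd; [rewrite ltnNge ps | rewrite nth_default // size_entries].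
have [numE denE] := nth_flatten_pairs numq denq 0 ps.
rewrite {1}pE; case: odd; first by rewrite -size_entries ps denE.
by rewrite addn0 numE.
Qed.

Definition denom : int := \prod_(1 <= h < Q.+1) den0 h.
Local Notation D := denom.

Lemma den0_gt0 (q : nat) : (0 < q <= Q)%N -> 0 < den0 q.
Proof. by case: q => // q qQ; rewrite /= ifT // denq_gt0. Qed.

Lemma prod_den_gt0 (p q : nat) : (0 < p)%N -> (q <= Q.+1)%N ->
  0 < \prod_(p <= h < q) den0 h.
Proof.
move=> p0 qQ; rewrite big_nat; apply: prodr_gt0 => h hpq.
by apply: den0_gt0; lia.
Qed.

Lemma prod_den_le (p : nat) : (p <= Q)%N ->
  \prod_(p.+1 <= h < Q.+1) den0 h <= D.
Proof.
move=> pQ; rewrite /denom [leRHS](big_cat_nat (n := p.+1)) //=.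
have lt1 : 0 < \prod_(1 <= h < p.+1) den0 h by apply: prod_den_gt0; lia.
have lt2 : 0 < \prod_(p.+1 <= h < Q.+1) den0 h by apply: prod_den_gt0.
by rewrite ler_peMl ?(ltW lt2) //; lia.
Qed.

Lemma denom_gt0 : 0 < D.
Proof. exact: prod_den_gt0. Qed.

Lemma den0_dvd (q : nat) : (0 < q <= Q)%N -> (den0 q %| D)%Z.
Proof.
move=> qQ; rewrite /denom (bigD1_seq q) ?iota_uniq ?mem_index_iota //=.
exact: dvdz_mulr.
Qed.

Definition scaled (p : nat) : int :=
  if (0 < p <= Q)%N then (num0 p * D %/ den0 p)%Z else num0 p.

(** The division in [scaled] is exact, as every denominator is a factor of [D]. *)
Lemma scaledE (q : nat) : (q < Q)%N ->
  (scaled q.+1)%:~R = nth 0 cip_entries q * D%:~R :> rat.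
Proof.
move=> qQ; rewrite /scaled ifT //.
have den_neq0 : (den0 q.+1)%:~R != 0 :> rat.
  by rewrite intr_eq0 gt_eqF // den0_gt0.
apply: (mulIf den_neq0); rewrite -intrM divzK; last first.
  by rewrite dvdz_mull // den0_dvd.
rewrite intrM mulrAC; congr (_ * _).
rewrite /= qQ -{2}(divq_num_den (nth 0 cip_entries q)) divfK //.
by rewrite intr_eq0 denq_neq0.
Qed.

Lemma scaled_ge0 (q : nat) : (0 < q <= Q)%N -> 0 <= scaled q.
Proof.
case: q => // q qQ; rewrite -(ler0z rat) scaledE //.
by rewrite mulr_ge0 ?entries_ge0 // ler0z ltW // denom_gt0.
Qed.

Definition free (j : nat) : bool := scaled j <= 0.

(** The whole array called [A] in the analysis of the greedy algorithm: costs at the indices up to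
    [n], matrix entries after them. *)
Definition prices (j : nat) : int :=
  if (0 < j <= n)%N && (scaled j <= 0) then 1 else scaled j.

(** Index 0 and the indices beyond [Q] keep their initial contents, since this must describe the
    entire odd half of memory. *)
Definition spent0 (j : nat) : int :=
  if (0 < j <= n)%N && (scaled j <= 0) then D
  else if (0 < j <= Q)%N then 0 else den0 j.

Local Notation isvar j := (0 < j <= n)%N.

Lemma prices_gt0 (j : nat) : isvar j -> 0 < prices j.
Proof. by rewrite /prices => ->/=; case: ifP => //; lia. Qed.

Lemma prices_free (j : nat) : isvar j -> free j -> prices j = 1.
Proof. by rewrite /prices /free => -> ->. Qed.

Lemma prices_entry (i j : nat) : (0 < i)%N -> isvar j ->
  prices (i * n + j) = scaled (i * n + j).
Proof. by move=> i0 jn; rewrite /prices ifF //; nia. Qed.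

Lemma prices_matrix (i : 'I_m) (j : 'I_n) :
  (prices (i.+1 * n + j.+1))%:~R = cip_A I i j * D%:~R.
Proof.
have jn := ltn_ord j; have im := ltn_ord i.
rewrite prices_entry // addnS scaledE; last by nia.
by rewrite mulSn -addnA nth_entries_matrix.
Qed.

Lemma true_cost_scaled (j : nat) : isvar j ->
  true_cost prices free j = scaled j.
Proof.
move=> jn; rewrite /true_cost /free /prices jn /=; case: lerP => // s_le0.
by apply/eqP; rewrite eq_le s_le0 scaled_ge0 //; lia.
Qed.

Lemma entry_ge0 (i j : nat) : (0 < i <= m)%N -> isvar j ->
  0 <= prices (i * n + j).
Proof.
by move=> im jn; rewrite prices_entry ?scaled_ge0 //; nia.
Qed.

Lemma entries_sparse (i : nat) : (0 < i <= m)%N ->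
  (count (fun j => (0 < prices (i * n + j))%R) (index_iota 1 n.+1) <= k)%N.
Proof.
case: i => // i im; have [_ _ /(_ (Ordinal im))] := Ik; apply: leq_trans.
rewrite /index_iota subn1 (iotaDl 1 0) -val_enum_ord -map_comp count_map.
rewrite cardE enumT -size_filter; apply: eq_leq; congr size.
rewrite /enum_mem; apply: eq_filter => j; rewrite /= !inE add1n.
rewrite -(ltr0z rat) (prices_matrix (Ordinal im) j) pmulr_lgt0; last first.
  by rewrite ltr0z denom_gt0.
by rewrite lt0r -nth_entries_matrix entries_ge0 andbT.
Qed.

(** Nothing has been spent on non-free variables, and what is unpaid is at most the full cost of
    [x]. *)
Lemma solvent_spent0 : solvent k n m D prices free spent0.
Proof.
have varQ j : isvar j -> (0 < j <= Q)%N by lia.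
split=> [j jn|j jn fj|x [x_ge0 _]].
- by rewrite /spent0; case: ifP => _; [exact/ltW/denom_gt0 | rewrite varQ].
- by rewrite /spent0 jn; rewrite /free in fj; rewrite fj.
rewrite big_seq big1 ?add0r => [|j]; last first.
  rewrite mem_vars => jn; case: ifP => // fj.
  by rewrite /spent0 jn -/(free j) fj varQ.
rewrite ler_wpM2l //; apply: sum_vars_le => j jn.
rewrite true_cost_scaled // ge_max mulr_ge0 ?scaled_ge0 ?x_ge0 ?varQ // andbT.
by rewrite gerBl /spent0; case: ifP => _; [exact/ltW/denom_gt0 | rewrite varQ].
Qed.

Lemma sum_matrix (i : 'I_m) (x : 'cV[int]_n) (x' : nat -> int) :
  (forall j : 'I_n, x' j.+1 = x j 0) ->
  (\sum_(1 <= j < n.+1) prices (i.+1 * n + j) * x' j)%:~R =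
  (cip_A I *m map_mx intr x) i 0 * D%:~R.
Proof.
move=> xE; rewrite sum_vars_ord rmorph_sum mxE mulr_suml; apply: eq_bigr => j _.
by rewrite rmorphM /= prices_matrix xE mxE mulrAC.
Qed.

Lemma sum_cost (x : 'cV[int]_n) (x' : nat -> int) :
  (forall j : 'I_n, x' j.+1 = x j 0) ->
  (\sum_(1 <= j < n.+1) true_cost prices free j * x' j)%:~R =
  cost I x * D%:~R.
Proof.
move=> xE; rewrite sum_vars_ord rmorph_sum /cost mxE mulr_suml.
apply: eq_bigr => j _; have jn := ltn_ord j.
rewrite rmorphM /= true_cost_scaled ?ltn_ord // scaledE; last by lia.
by rewrite nth_entries_cost xE mxE mulrAC.
Qed.

Definition extend (x : 'cV[int]_n) (j : nat) : int :=
  if insub j.-1 is Some h then x h 0 else 0.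

Lemma extendE (x : 'cV[int]_n) (j : 'I_n) : extend x j.+1 = x j 0.
Proof. by rewrite /extend /= valK. Qed.

Let D_rat_gt0 : 0 < D%:~R :> rat.
Proof. by rewrite ltr0z denom_gt0. Qed.

Lemma covering_extend (x : 'cV[int]_n) : feasible I x ->
  covering n m D prices (extend x).
Proof.
move=> [x_ge0 Ax]; split=> [j _|i im _].
  by rewrite /extend; case: insub.
case: i im => // i im; rewrite -(ler_int rat).
rewrite (@sum_matrix (Ordinal im) x) => [|j]; last exact: extendE.
by rewrite -[leLHS]mul1r ler_pM2r.
Qed.

Lemma coverable_of_feasible (x : 'cV[int]_n) (i : nat) : feasible I x ->
  (0 < i <= m)%N -> coverable n prices i.
Proof.
move=> [x_ge0 Ax] im; apply: NNPP => ncov; case: i im ncov => // i im ncov.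
have := Ax (Ordinal im); rewrite mxE big1 // => j _; rewrite !mxE.
suff -> : cip_A I (Ordinal im) j = 0 by rewrite mul0r.
apply/eqP/negPn/negP=> A_neq0; apply: ncov.
exists j.+1; first exact: ltn_ord.
rewrite -(ltr0z rat) (prices_matrix (Ordinal im) j) mulr_gt0 //.
by rewrite lt0r A_neq0 -nth_entries_matrix entries_ge0.
Qed.

(** Costs of feasible points become natural numbers when scaled by [D], so descent from a feasible
    point ends at a minimum. *)
Lemma exists_optimum (x0 : 'cV[int]_n) : feasible I x0 ->
  exists v, is_optimum I v.
Proof.
pose val (x : 'cV[int]_n) : int :=
  \sum_(1 <= j < n.+1) true_cost prices free j * extend x j.
have valE x : (val x)%:~R = cost I x * D%:~R by apply/sum_cost/extendE.
have val_ge0 x : feasible I x -> 0 <= val x.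
  move=> [x_ge0 _]; rewrite /val big_seq; apply: sumr_ge0 => j.
  rewrite mem_vars => jn; rewrite mulr_ge0 //.
    by rewrite true_cost_scaled // scaled_ge0 //; lia.
  by rewrite /extend; case: insub.
have [t] := ubnP `|val x0|%N; elim: t x0 => // t IH x0 lt_t x0P.
have [[x1 x1P lt_x1]|min0] :=
    classic (exists2 x1, feasible I x1 & val x1 < val x0).
  by apply: (IH x1) => //; have := val_ge0 _ x1P; lia.
exists (cost I x0); split; first by exists x0.
move=> x xP; rewrite -(ler_pM2r D_rat_gt0) -!valE ler_int leNgt.
by apply/negP=> lt_x; apply: min0; exists x.
Qed.

(** The copies bought cost at most the amount spent, and the invariant, applied to an optimal
    solution, bounds the spending by [k] times the optimum. *)
Lemma approximate_spent (U : nat -> int) (s : memory) :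
  (exists x, feasible I x) ->
  solvent k n m D prices free U ->
  (forall i, (0 < i <= m)%N -> coverable n prices i ->
     residual prices U n D i <= 0) ->
  (forall j, (j < n)%N -> s j%:Z = (U j.+1 %/ prices j.+1)%Z) ->
  approximate_solution k I (output I s).
Proof.
move=> [x0 x0P] Us resU sE; have [U_ge0 _ _] := Us.
pose y j := (U j %/ prices j)%Z.
have yE (j : 'I_n) : y j.+1 = output I s j 0 by rewrite mxE sE.
split; last first.
  have [v vopt] := exists_optimum x0P; exists v => //.
  have [[x xP <-] _] := vopt.
  rewrite -(ler_pM2r D_rat_gt0) -(sum_cost yE) -mulrA -(sum_cost (extendE x)).
  rewrite -[k%:R]/(k%:Z%:~R) -intrM ler_int.
  apply: le_trans (spent_le Us (covering_extend xP)).
  apply: sum_vars_le => j jn; rewrite /true_cost.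
  case: ifP => _; first by rewrite mul0r.
  by rewrite mulrC lez_floor // gt_eqF // prices_gt0.
split=> [j|i].
  by rewrite -yE divz_ge0 ?U_ge0 ?prices_gt0 ?ltn_ord.
rewrite -(ler_pM2r D_rat_gt0) mul1r -(sum_matrix _ yE) ler_int.
have im : (0 < i.+1 <= m)%N by exact: ltn_ord.
by have := resU _ im (coverable_of_feasible x0P im); rewrite /residual subr_le0.
Qed.

(** * Bit lengths of the intermediate numbers *)

Local Notation L := (input_size (encode I)).
Local Notation X := (2 ^ L)%N%:Z.
(** With [X = 2 ^ L], the numbers [n] and [D] are below [X] and scaled entries below [X ^ 2].
    Spending is at most [2 ^ k * X ^ 4], where [2 ^ k] absorbs [k + 1], and a row sum is at most
    [X ^ 3]. The largest quantity, [D] plus their product, is thus at most [2 ^ k * X ^ 8], strictly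
    below [2 ^ B]. *)
Local Notation B := (9 * L + k)%N.
Local Notation top := (2 ^ B)%N%:Z.

Lemma input_sizeE : L = (bitlen m%:Z + bitlen n%:Z +
  \sum_(q <- cip_entries) (bitlen (numq q) + bitlen (denq q)))%N.
Proof.
rewrite encodeE /input_size /= !big_cons addnA.
congr (_ + _)%N; elim: cip_entries => [|q s IH]; first by rewrite !big_nil.
by rewrite /= !big_cons IH addnA.
Qed.

Lemma entries_le_size : (Q <= L)%N.
Proof.
rewrite input_sizeE -size_entries -sum1_size; apply: leq_trans (leq_addl _ _).
by apply: leq_sum => q _; apply: leq_trans (leq_addr _ _).
Qed.

Lemma denom_lt : D < X.
Proof.
have -> : D = \prod_(q <- cip_entries) denq q.
  rewrite /denom big_add1 [RHS](big_nth 0) size_entries !big_mkord /=.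
  by apply: eq_bigr => h _; rewrite ltn_ord.
apply: le_lt_trans (prod_den_lt _) _; rewrite ltz_nat ltn_exp2l // input_sizeE.
by rewrite big_split /= addnCA; have := bitlen_gt0 m; lia.
Qed.

Lemma num0_lt (p : nat) : (`|num0 p| < 2 ^ L)%N.
Proof.
have L_gt0 : (0 < L)%N by rewrite input_sizeE.
have := bounded_load L_gt0 (Posz (2 * p)).
by rewrite load_encode /= interleave_even bitlen_leP.
Qed.

Lemma scaled_lt (p : nat) : (0 < p <= Q)%N -> scaled p < X * X.
Proof.
move=> pQ; rewrite /scaled pQ.
have := lez_div (num0 p * D) (den0 p); have := num0_lt p; have := denom_lt.
rewrite abszM; have := denom_gt0.
by move: D (2 ^ L)%N (num0 p) (divz _ _) => d x a z; nia.
Qed.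

Lemma prices_lt (p : nat) : (0 < p <= Q)%N -> prices p < X * X.
Proof.
move=> pQ; rewrite /prices; case: ifP => _; last exact: scaled_lt.
by have := denom_lt; have := denom_gt0; move: D (2 ^ L)%N => d x; nia.
Qed.

Lemma size_lt : n%:Z < X /\ Q%:Z < X.
Proof.
have := entries_le_size; have : (L < 2 ^ L)%N by rewrite ltn_expl.
by move: (2 ^ L)%N => x; lia.
Qed.

Lemma sum_le_size (F : nat -> int) (e : int) : 0 <= e ->
  (forall j, isvar j -> F j <= e) -> \sum_(1 <= j < n.+1) F j <= X * e.
Proof.
move=> e_ge0 Fe; apply: le_trans (_ : _ <= \sum_(1 <= j < n.+1) e) _.
  exact: sum_vars_le.
rewrite big_const_nat iter_addr_0 subn1 -mulr_natl natz ler_wpM2r //.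
by case: size_lt => /ltW.
Qed.

Lemma X_ge2 : 2 <= X.
Proof. by have := denom_lt; have := denom_gt0; lia. Qed.

Lemma topE : top = (2 ^ k)%N%:Z * X ^+ 9.
Proof.
have powZ (a p : nat) : (a ^ p)%N%:Z = a%:Z ^+ p.
  by rewrite -!natz natrX.
by rewrite expnD (mulnC 9 L) expnM PoszM mulrC (powZ (2 ^ L)%N).
Qed.

Lemma pow_lt_top (p : nat) : (p < 9)%N -> (2 ^ k)%N%:Z * X ^+ p < top.
Proof.
move=> p9; rewrite topE ltr_pM2l; last by rewrite ltz_nat expn_gt0.
by rewrite ltr_eXn2l //; apply: lt_le_trans X_ge2.
Qed.

Lemma pow_le_top (p : nat) : X ^+ p <= (2 ^ k)%N%:Z * X ^+ p.
Proof. by rewrite ler_peMl ?exprn_ge0 // lez_nat expn_gt0. Qed.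

Lemma spending_bound_le :
  spending_bound k n D prices free <= (2 ^ k)%N%:Z * X ^+ 4.
Proof.
have X2 := X_ge2.
have sum_le :
    \sum_(1 <= j < n.+1) true_cost prices free j * D <= X * (X * X * X).
  apply: sum_le_size => [|j jn]; first by rewrite !mulr_ge0 //; lia.
  rewrite true_cost_scaled // ler_pM ?scaled_ge0 ?(ltW denom_gt0) //; try lia.
    by apply/ltW/scaled_lt; lia.
  exact/ltW/denom_lt.
have k_lt : k%:Z + 1 <= (2 ^ k)%N%:Z by have := ltn_expl k (ltnSn 1); lia.
have D_le : D <= X ^+ 4.
  apply: le_trans (ltW denom_lt) _; rewrite -[leLHS]expr1 ler_weXn2l //.
  by apply: le_trans X2.
rewrite /spending_bound; apply: le_trans (_ : _ <= (k%:Z + 1) * X ^+ 4) _.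
  rewrite mulrDl mul1r addrC lerD // ler_wpM2l //.
  by apply: le_trans sum_le _; rewrite !exprS expr0 mulr1 !mulrA.
by rewrite ler_wpM2r // exprn_ge0 //; lia.
Qed.

Lemma run_cip_prog :
  exists s U,
  [/\ run (k * L) B (cip_prog k) (load (encode I)) s,
      solvent k n m D prices free U,
      forall i, (0 < i <= m)%N -> coverable n prices i ->
        residual prices U n D i <= 0
    & forall j, (j < n)%N -> s j%:Z = (U j.+1 %/ prices j.+1)%Z].
Proof.
have B_gt0 : (0 < B)%N by lia.
have L_le : (L <= k * L)%N by rewrite leq_pmull.
have QN : (Q <= k * L)%N := leq_trans entries_le_size L_le.
have nN : (n <= k * L)%N := leq_trans (leq_addr _ _) QN.
have X2 := X_ge2.
have XX_top : X * X < top.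
  by rewrite -expr2; apply: le_lt_trans (pow_le_top 2) (pow_lt_top _).
have X_top : X < top by nia.
have fitsX z : - top < z < top -> (bitlen z <= B)%N.
  by rewrite bitlen_leP //; lia.
have [n_lt Q_lt] := size_lt.
have nB : (bitlen n%:Z <= B)%N by apply: fitsX; lia.
have mX : m%:Z < X by have := num0_lt 0; rewrite /num0; lia.
have mB : (bitlen m%:Z <= B)%N by apply: fitsX; lia.
have QB : (bitlen Q%:Z <= B)%N by apply: fitsX; lia.
have DX := denom_lt; have D0 := denom_gt0.
have DB : (bitlen D <= B)%N by apply: fitsX; lia.
have bound_top : spending_bound k n D prices free < top.
  exact: le_lt_trans spending_bound_le (pow_lt_top _).
have price_top j : isvar j -> prices j * D < top.
  move=> jn; have jQ : (0 < j <= Q)%N by lia.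
  have := prices_lt jQ; have := prices_gt0 jn => p0 pX.
  apply: le_lt_trans (_ : X ^+ 3 < _).
    by rewrite exprSr expr2 ler_pM //; lia.
  exact: le_lt_trans (pow_le_top 3) (pow_lt_top _).
have row_top i : (0 < i <= m)%N ->
    D + (\sum_(1 <= j < n.+1) prices (i * n + j)) *
      spending_bound k n D prices free < top.
  move=> im.
  have sum_le : \sum_(1 <= j < n.+1) prices (i * n + j) <= X * (X * X).
    apply: sum_le_size => [|j jn]; first by rewrite mulr_ge0.
    by apply/ltW/prices_lt; nia.
  apply: le_lt_trans (_ : D + X * (X * X) * ((2 ^ k)%N%:Z * X ^+ 4) < _).
    rewrite lerD2l ler_pM ?spending_bound_le //.
      rewrite big_seq; apply: sumr_ge0 => j.
      by rewrite mem_vars => /entry_ge0->.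
    apply: le_trans (ltW D0) _; apply: scale_le_bound => //.
    exact: prices_gt0.
  rewrite -expr2 -exprS mulrCA -exprD.
  apply: le_lt_trans (pow_lt_top (p := 8) _) => //.
  have D_le : D <= (2 ^ k)%N%:Z * X ^+ 7.
    apply: le_trans (pow_le_top 7); apply: le_trans (ltW DX) _.
    by rewrite -[leLHS]expr1 ler_weXn2l //; lia.
  rewrite (exprS _ 7) mulrCA; move: D_le.
  by move: ((2 ^ k)%N%:Z * X ^+ 7) X X2 => E Y Y2 DE; nia.
rewrite load_encode.
have [U [q' [i' [f' [r' [b' [runU Us resU]]]]]]] : exists U q' i' f' r' b',
  [/\ run (k * L) B (IfPos cols (for_down 4 (prog_row k)) Skip)
        (ram (interleave prices spent0) [:: n%:Z; m%:Z; D; 0; m%:Z; 0; 0; 0])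
        (ram (interleave prices U) [:: n%:Z; m%:Z; D; q'; i'; f'; r'; b']),
      solvent k n m D prices free U
    & forall i, (0 < i <= m)%N -> coverable n prices i ->
        residual prices U n D i <= 0].
  (* Without variables no row is coverable and the row loop is skipped. With a variable,
     [m <= m * n <= Q], so the number of rows is within the iteration bound. *)
  case: (ltrP 0 n%:Z) => n0; last first.
    exists spent0, 0, m%:Z, 0, 0, 0; split; first 2 last.
    - by move=> i _ [j jn _]; lia.
    - by apply: (run_if_npos B_gt0) => //; exact: run_skip.
    - exact: solvent_spent0.
  have mN : (m <= k * L)%N by nia.
  have [||U [q' [f' [r' [b' [runU Us resU]]]]]] :=
    @run_rows k n m D prices free k_gt0 D0 prices_gt0 prices_free entry_ge0
      entries_sparse (k * L)%N B L B_gt0 nN mN (leqnn _) DX _ _ bound_top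
      price_top row_top spent0 0 0 0 0 solvent_spent0.
  - by lia.
  - by lia.
  by exists U, q', 0, f', r', b'; split=> //; apply: (run_if_pos B_gt0).
have U_bound j : isvar j -> 0 <= U j <= spending_bound k n D prices free.
  exact: (solvent_le_bound k_gt0 D0 prices_gt0 entry_ge0 Us).
have outB j : isvar j -> (bitlen (U j %/ prices j)%Z <= B)%N.
  move=> jn; have := U_bound j jn; have := lez_div (U j) (prices j) => le_div.
  by move=> ?; apply: fitsX; lia.
have [s run_s sE] := run_output B_gt0 m nN nB D q' i' f' r' b' outB.
exists s, U; split=> //.
apply: run_seq; first by apply: (run_store B_gt0); last exact: update_ram_neg.
apply: run_seq; first by apply: (run_store B_gt0); last exact: update_ram_neg.
rewrite /= /interleave /=.
apply: run_seq.
  apply: run_denominators => // p pQ; apply: fitsX.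
  have := prod_den_le pQ; have : 0 < \prod_(p.+1 <= h < Q.+1) den0 h.
    exact: prod_den_gt0.
  by lia.
apply: run_seq.
  apply: run_scale => // p pQ; apply: fitsX.
  have := scaled_lt pQ; have := scaled_ge0 pQ; rewrite /scaled pQ.
  by lia.
apply: run_seq; first exact: run_free_variables.
apply: run_seq; first by apply: (run_store B_gt0); last exact: update_ram_neg.
exact: run_seq runU run_s.
Qed.

End Instance.

Theorem theorem4 (k : nat) (hk : (2 <= k)%N) :
  exists P : prog,
    polynomial_time (row_sparse_cip k) P /\
    approximation_algorithm k (row_sparse_cip k) P.
Proof.
have k_gt0 : (0 < k)%N by apply: ltnW.
exists (cip_prog k).
have total I : row_sparse_cip k I -> exists s t,
  let L := input_size (encode I) in
  [/\ exec (cip_prog k) (load (encode I)) s t,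
      (t <= prog_cost (k * L) (cip_prog k) * (9 * L + k))%N
    & (exists x, feasible I x) -> approximate_solution k I (output I s)].
  move=> Ik; have [s [U [run_s Us resU sE]]] := run_cip_prog k_gt0 Ik.
  have [|_ [t ex tB]] := run_s.
    have L_gt0 : (0 < input_size (encode I))%N by rewrite input_sizeE.
    by move=> a; apply: leq_trans (bounded_load L_gt0 a) _; lia.
  exists s, t; split=> // feas.
  exact: (approximate_spent k_gt0 Ik feas Us resU sE).
split.
  have [p pE] := prog_cost_poly (cip_prog k) k.
  (* The factor [p] evaluates the static cost for loops of at most [k * L] rounds; the other factor
     is the number of bits per cell. *)
  exists (p * (9%:P * 'X + k%:P)) => I Ik.
  have [s [t [ex tB _]]] := total I Ik; exists s, t; split=> //.
  by rewrite hornerM hornerD hornerM !hornerC hornerX pE.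
move=> I Ik feas s t ex; have [s' [t' [ex' _ appr]]] := total I Ik.
by rewrite (exec_det ex ex'); apply: appr.
Qed.
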